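(* Let $M$ be a message set such that $G_M$ is an oriented ring. The problem of deciding whether a given $M$-system is synchronizable is decidable.
   Context: A message set $M=(\Sigma_M,N,\mathrm{src},\mathrm{dst})$: finite set of messages, $N\ge1$ peers, $\mathrm{src}(a)\neq\mathrm{dst}(a)\in\{1,\dots,N\}$. Its communication topology $G_M$ is the directed graph on $\{1,\dots,N\}$ with an edge $i\to j$ iff some message $a$ has $\mathrm{src}(a)=i$, $\mathrm{dst}(a)=j$; $G_M$ is an oriented ring if its edge set is exactly $\{(i,j)\mid j=i+1 \bmod N\}$. Actions $!a$ (by peer $\mathrm{src}(a)$), $?a$ (by peer $\mathrm{dst}(a)$); traces are finite action sequences; $!?a$ abbreviates $!a\cdot?a$. For a trace $\tau$, $\pi_!(\tau)$ is the sequence of sent messages; $\mathrm{buf}_{i\to j}(\tau)$ is the word $w$ (if any) with (sent on $i\to j$) $=$ (received on $i\to j$)$\cdot w$. $\tau$ is FIFO ($k$-bounded FIFO) if for all $i,j$ and prefixes $\tau'$, $\mathrm{buf}_{i\to j}(\tau')$ is defined (and has length $\le k$); synchronous if of the form $!?a_1\cdots!?a_k$. An $M$-system $S=(P_1,\dots,P_N)$: finite automata $P_i$ (all states accepting) over actions of peer $i$, with one FIFO channel per ordered pair $i\neq j$. A configuration: one control state per peer and contents $w_{i,j}$ of channels; stable if all channels empty. $!a$ ($\mathrm{src}(a)=i,\mathrm{dst}(a)=j$) moves $P_i$ and appends $a$ to $w_{i,j}$; $?a$ moves $P_j$ and removes $a$ from the head of $w_{i,j}$; $c_0$ is the initial configuration.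 $T_k(S)$ ($k\ge1$): $k$-bounded FIFO traces $\tau$ with $c_0\xrightarrow{\tau}c$ for some $c$; $T_0(S)$: synchronous such traces; $T_\omega(S)=\bigcup_kT_k(S)$. $ST_k(S)=\{\pi_!(\tau)\mid\tau\in T_k(S)\}\cup\{(\pi_!(\tau),c)\mid c_0\xrightarrow{\tau}c,\ c\text{ stable},\ \tau\in T_k(S)\}$. $S$ is synchronizable if $ST_0(S)=ST_\omega(S)$. *)

(* Defs.v *)
From mathcomp Require Import all_boot.
Set Implicit Arguments. Unset Strict Implicit. Unset Printing Implicit Defensive.

Inductive recfun : Type :=
| RZero : recfun
| RSucc : recfun
| RProj : nat -> recfun
| RComp : recfun -> list recfun -> recfun
| RPrimRec : recfun -> recfun -> recfun
| RMu : recfun -> recfun.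

Inductive eval : recfun -> seq nat -> nat -> Prop :=
| ev_zero v : eval RZero v 0
| ev_succ x v : eval RSucc (x :: v) x.+1
| ev_proj i v : eval (RProj i) v (nth 0 v i)
| ev_comp f gs v ys y : evals gs v ys -> eval f ys y -> eval (RComp f gs) v y
| ev_prec0 f g v y : eval f v y -> eval (RPrimRec f g) (0 :: v) y
| ev_precS f g n v y z :
    eval (RPrimRec f g) (n :: v) y -> eval g (n :: y :: v) z ->
    eval (RPrimRec f g) (n.+1 :: v) z
| ev_mu f v n :
    eval f (n :: v) 0 ->
    (forall k, k < n -> exists y, eval f (k :: v) y /\ y <> 0) ->
    eval (RMu f) v n
with evals : list recfun -> seq nat -> seq nat -> Prop :=
| evs_nil v : evals nil v [::]
| evs_cons g gs v y ys : eval g v y -> evals gs v ys -> evals (g :: gs) v (y :: ys).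

Definition decidable_pred (T : countType) (P : T -> Prop) : Prop :=
  exists p : recfun, forall x : T,
    (P x -> eval p [:: pickle x] 1) /\ (~ P x -> eval p [:: pickle x] 0).

(* Peers are 'I_N (i.e. 0..N-1 instead of 1..N), messages are 'I_m.   *)
Section Systems.
Variables (N m : nat) (src dst : 'I_m -> 'I_N).

Definition oriented_ring : Prop :=
  forall i j : 'I_N, (exists a, src a = i /\ dst a = j) <-> val j = (val i).+1 %% N.

(* an action: (true, a) is !a, (false, a) is ?a *)
Definition action := (bool * 'I_m)%type.
Definition peer_of (x : action) : 'I_N := if x.1 then src x.2 else dst x.2.

(* An M-system: for every peer i, a finite automaton given by an initial
   state and a finite list of transitions (q, x, q') (all states accepting).
   Only transitions labelled with actions of peer i are ever used, so this
   represents exactly the automata over the actions of peer i. *)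
Definition system := {ffun 'I_N -> nat * seq (nat * action * nat)}.

Record config := Config { cst : 'I_N -> nat; cch : 'I_N -> 'I_N -> seq 'I_m }.

Definition c0 (S : system) : config := Config (fun i => (S i).1) (fun _ _ => [::]).

Definition stable (c : config) : Prop := forall i j, cch c i j = [::].

Definition set_state (c : config) (p : 'I_N) (q : nat) : 'I_N -> nat :=
  fun i => if i == p then q else cst c i.

Definition set_chan (c : config) (i j : 'I_N) (w : seq 'I_m) : 'I_N -> 'I_N -> seq 'I_m :=
  fun i' j' => if (i' == i) && (j' == j) then w else cch c i' j'.

Inductive step (S : system) : config -> action -> config -> Prop :=
| step_send c a q' :
    (cst c (src a), (true, a), q') \in (S (src a)).2 ->
    step S c (true, a)
      (Config (set_state c (src a) q') (set_chan c (src a) (dst a) (rcons (cch c (src a) (dst a)) a)))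
| step_recv c a w q' :
    cch c (src a) (dst a) = a :: w ->
    (cst c (dst a), (false, a), q') \in (S (dst a)).2 ->
    step S c (false, a)
      (Config (set_state c (dst a) q') (set_chan c (src a) (dst a) w)).

Inductive run (S : system) : config -> seq action -> config -> Prop :=
| run_nil c : run S c [::] c
| run_cons c x c' t c'' : step S c x c' -> run S c' t c'' -> run S c (x :: t) c''.

Definition sends (t : seq action) : seq 'I_m := [seq x.2 | x <- t & x.1].

Definition sent_on (i j : 'I_N) (t : seq action) : seq 'I_m :=
  [seq x.2 | x <- t & [&& x.1, src x.2 == i & dst x.2 == j]].
Definition recv_on (i j : 'I_N) (t : seq action) : seq 'I_m :=
  [seq x.2 | x <- t & [&& ~~ x.1, src x.2 == i & dst x.2 == j]].

Definition buf (i j : 'I_N) (t : seq action) : option (seq 'I_m) :=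
  if prefix (recv_on i j t) (sent_on i j t)
  then Some (drop (size (recv_on i j t)) (sent_on i j t)) else None.

Definition fifo_trace (t : seq action) : Prop :=
  forall n i j, buf i j (take n t) <> None.

Definition kfifo_trace (k : nat) (t : seq action) : Prop :=
  forall n i j, exists w, buf i j (take n t) = Some w /\ size w <= k.

Definition synchronous (t : seq action) : Prop :=
  exists s : seq 'I_m, t = flatten [seq [:: (true, a); (false, a)] | a <- s].

Definition executable (S : system) (t : seq action) : Prop :=
  exists c, run S (c0 S) t c.

Definition T (k : nat) (S : system) (t : seq action) : Prop :=
  (if k is 0 then synchronous t else kfifo_trace k t) /\ executable S t.

Definition Tomega (S : system) (t : seq action) : Prop := exists k, T k S t.

Definition ST (TS : seq action -> Prop) (S : system)
    (x : seq 'I_m + (seq 'I_m * config)) : Prop :=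
  match x with
  | inl w => exists t, TS t /\ sends t = w
  | inr (w, c) => exists t, TS t /\ run S (c0 S) t c /\ stable c /\ sends t = w
  end.

Definition synchronizable (S : system) : Prop :=
  forall x, ST (T 0 S) S x <-> ST (Tomega S) S x.

End Systems.

(* Main.v *)
(* Only the following property of oriented rings matters: each peer receives
   from a single peer. Let [S] satisfy [almost_sync]: whenever a trace
   w.!a.u, with w and u synchronous and u not involving the channel of a, is
   extended by at most one action of dst(a), the resulting sequence of sends is
   also that of a synchronous trace, reaching the same stable configuration if
   that action is ?a. In an arbitrary trace !a.t, the peer dst(a) only sends
   before it receives a; [almost_sync] then lets it receive a immediately after
   !a, and by induction the whole trace becomes synchronous. Hence [almost_sync]
   is equivalent to synchronizability. It only involves finitely many control
   states, one message in transit, and the subset construction of the automaton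
   of synchronous traces, so it is decided by exploring a finite graph. *)
From Stdlib Require Import FunctionalExtensionality.
Require Import Defs.
From mathcomp Require Import all_boot.
Set Implicit Arguments. Unset Strict Implicit. Unset Printing Implicit Defensive.

(** * Recursive functions on codes *)

(** Decidability asks for an actual [recfun], so every function used by the decision procedure needs
    a recursive counterpart on codes; the exploration is therefore written with lists, folds and
    filters only. The number of rounds is found by minimisation: termination needs a finite list
    that contains all nodes to exist, but that list is never computed. The automata are
    nondeterministic, so one word of sends may lead synchronous traces to many control vectors.
    Whether some vector, or a prescribed one, is reached depends on the whole set of them, which is
    why nodes carry that set. One message in transit is enough because the trace before the emission
    under consideration has already been made synchronous. Conversely, the traces in [almost_sync]
    are genuine runs of the system, so its clauses are instances of synchronizability. *)

Definition crec k (F : seq nat -> nat) : Prop :=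
  exists p, forall v, size v = k -> eval p v (F v).

Lemma crec_ext k (F G : seq nat -> nat) :
  (forall v, size v = k -> F v = G v) -> crec k F -> crec k G.
Proof. by move=> FG [p pF]; exists p => v kv; rewrite -FG //; apply: pF. Qed.

Lemma crec_proj k i : crec k (fun v => nth 0 v i).
Proof. by exists (RProj i) => v _; apply: ev_proj. Qed.

Lemma crec_comp k (F : seq nat -> nat) (Gs : seq (seq nat -> nat)) :
  crec (size Gs) F -> foldr (fun G P => crec k G /\ P) True Gs ->
  crec k (fun v => F [seq G v | G <- Gs]).
Proof.
move=> [p pF] allG.
suff [ps psG] : exists ps, forall v, size v = k -> evals ps v [seq G v | G <- Gs].
  exists (RComp p ps) => v kv; apply: ev_comp (psG v kv) _.
  by apply: pF; rewrite size_map.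
elim: Gs allG {pF} => [_|G Gs IH [[q qG] /IH[ps psG]]].
  by exists [::] => v _; apply: evs_nil.
by exists (q :: ps) => v kv; apply: evs_cons; [apply: qG|apply: psG].
Qed.

Lemma crec_succ k F : crec k F -> crec k (fun v => (F v).+1).
Proof.
move=> hF; apply: (@crec_comp k (fun v => (nth 0 v 0).+1) [:: F]) => //.
by exists RSucc => -[|x v] //= _; apply: ev_succ.
Qed.

Lemma crec_const k c : crec k (fun=> c).
Proof.
elim: c => [|c IH]; last exact: crec_succ.
by exists RZero => v _; apply: ev_zero.
Qed.

(** Composition replaces the whole argument vector; listing all projections hands the parameters on
    unchanged. *)
Lemma evals_proj v : evals [seq RProj i | i <- iota 0 (size v)] v v.
Proof.
suff H n j : j + n = size v -> evals [seq RProj i | i <- iota j n] v (drop j v).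
  by rewrite -{3}[v]drop0; apply: H.
elim: n j => [|n IH] j jn /=.
  by rewrite drop_oversize ?addn0 -?jn ?addn0 //; apply: evs_nil.
rewrite (drop_nth 0) -?jn ?addnS ?ltnS ?leq_addr //.
by apply: evs_cons; [apply: ev_proj|apply: IH; rewrite addSnnS].
Qed.

(** [RPrimRec] takes its bound as first argument, so the computed bound is put in front of a copy of
    the parameters. In the step function, index 0 is the counter, index 1 the accumulator, and the
    parameters start at index 2. *)
Lemma crec_iteri k (n z : seq nat -> nat) (g : seq nat -> nat) :
  crec k n -> crec k z -> crec k.+2 g ->
  crec k (fun v => iteri (n v) (fun i y => g (i :: y :: v)) (z v)).
Proof.
move=> [pn hn] [pz hz] [pg hg].
exists (RComp (RPrimRec pz pg) (pn :: [seq RProj i | i <- iota 0 k])) => v kv.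
apply: (@ev_comp _ _ _ (n v :: v)).
  by apply: evs_cons; [apply: hn|rewrite -kv; apply: evals_proj].
elim: (n v) => [|j IH] /=; first by apply: ev_prec0; apply: hz.
by apply: ev_precS IH _; apply: hg; rewrite /= kv.
Qed.

Lemma crec_mu k (F H : seq nat -> nat) :
  crec k.+1 F ->
  (forall v, size v = k ->
    F (H v :: v) = 0 /\ forall j, j < H v -> F (j :: v) <> 0) ->
  crec k H.
Proof.
move=> [p pF] HF; exists (RMu p) => v kv; have [H0 Hlt] := HF v kv.
apply: ev_mu => [|j /Hlt ?]; first by rewrite -H0; apply: pF; rewrite /= kv.
by exists (F (j :: v)); split=> //; apply: pF; rewrite /= kv.
Qed.

(** * Arithmetic as recursive functions *)

Definition crec1 (f : nat -> nat) := crec 1 (fun v => f (nth 0 v 0)).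
Definition crec2 (f : nat -> nat -> nat) :=
  crec 2 (fun v => f (nth 0 v 0) (nth 0 v 1)).
Definition crec3 (f : nat -> nat -> nat -> nat) :=
  crec 3 (fun v => f (nth 0 v 0) (nth 0 v 1) (nth 0 v 2)).

Lemma crec_app1 k f F : crec1 f -> crec k F -> crec k (fun v => f (F v)).
Proof.
by move=> hf hF; apply: (@crec_comp k (fun v => f (nth 0 v 0)) [:: F]).
Qed.

Lemma crec_app2 k f F G :
  crec2 f -> crec k F -> crec k G -> crec k (fun v => f (F v) (G v)).
Proof.
move=> hf hF hG.
by apply: (@crec_comp k (fun v => f (nth 0 v 0) (nth 0 v 1)) [:: F; G]).
Qed.

Lemma crec_app3 k f F G H :
  crec3 f -> crec k F -> crec k G -> crec k H ->
  crec k (fun v => f (F v) (G v) (H v)).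
Proof.
move=> hf hF hG hH.
by apply: (@crec_comp k (fun v => f (nth 0 v 0) (nth 0 v 1) (nth 0 v 2))
                      [:: F; G; H]).
Qed.

Lemma crec2_addn : crec2 addn.
Proof.
apply: crec_ext (crec_iteri (crec_proj 2 1) (crec_proj 2 0)
  (crec_succ (crec_proj 4 1))) => v _ /=.
by elim: (nth 0 v 1) => [|n IH] /=; rewrite ?addn0 // IH addnS.
Qed.

Lemma crec2_muln : crec2 muln.
Proof.
apply: crec_ext (crec_iteri (crec_proj 2 1) (crec_const 2 0)
  (crec_app2 crec2_addn (crec_proj 4 2) (crec_proj 4 1))) => v _ /=.
by elim: (nth 0 v 1) => [|n IH] /=; rewrite ?muln0 // IH mulnS.
Qed.

Lemma crec1_exp2 : crec1 (expn 2).
Proof.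
apply: crec_ext (crec_iteri (crec_proj 1 0) (crec_const 1 1)
  (crec_app2 crec2_addn (crec_proj 3 1) (crec_proj 3 1))) => v _ /=.
by elim: (nth 0 v 0) => [|n IH] //=; rewrite IH expnS mul2n addnn.
Qed.

Lemma crec1_pred : crec1 predn.
Proof.
apply: crec_ext (crec_iteri (crec_proj 1 0) (crec_const 1 0)
  (crec_proj 3 0)) => v _ /=.
by case: (nth 0 v 0).
Qed.

Lemma crec2_subn : crec2 subn.
Proof.
apply: crec_ext (crec_iteri (crec_proj 2 1) (crec_proj 2 0)
  (crec_app1 crec1_pred (crec_proj 4 1))) => v _ /=.
by elim: (nth 0 v 1) => [|n IH] /=; rewrite ?subn0 // IH subnS.
Qed.

Lemma crec1_odd : crec1 odd.
Proof.
apply: crec_ext (crec_iteri (crec_proj 1 0) (crec_const 1 0)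
  (crec_app2 crec2_subn (crec_const 3 1) (crec_proj 3 1))) => v _ /=.
by elim: (nth 0 v 0) => [|n IH] //=; rewrite IH; case: (odd n).
Qed.

(** Passing from [n] to [n.+1] raises the half exactly when [n] is odd; the counter at index 0
    provides that [n]. *)
Lemma crec1_half : crec1 half.
Proof.
apply: crec_ext (crec_iteri (crec_proj 1 0) (crec_const 1 0)
  (crec_app2 crec2_addn (crec_app1 crec1_odd (crec_proj 3 0))
     (crec_proj 3 1))) => v _ /=.
by elim: (nth 0 v 0) => [|n IH] //=; rewrite IH -uphalf_half.
Qed.

Definition shr k c := iter k half c.

Lemma crec2_shr : crec2 shr.
Proof.
apply: crec_ext (crec_iteri (crec_proj 2 0) (crec_proj 2 1)
  (crec_app1 crec1_half (crec_proj 4 1))) => v _ /=.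
by elim: (nth 0 v 0) => [|n IH] //=; rewrite IH.
Qed.

(** With truncated subtraction, [(x - y) + (y - x)] vanishes only on the diagonal; subtracting it
    from 1 gives the truth value. *)
Lemma crec2_eqn : crec2 (fun x y => x == y).
Proof.
apply: crec_ext (crec_app2 crec2_subn (crec_const 2 1) (crec_app2 crec2_addn
  (crec_app2 crec2_subn (crec_proj 2 0) (crec_proj 2 1))
  (crec_app2 crec2_subn (crec_proj 2 1) (crec_proj 2 0)))) => v _ /=.
by rewrite eqn_leq -!subn_eq0 -addn_eq0; case: (_ + _).
Qed.

Definition if_nat (b x y : nat) := if b == 0 then y else x.

(** The test value serves as the number of rounds of a constant step: no round leaves the else
    branch, any positive number of rounds yields the other one. *)
Lemma crec3_if : crec3 if_nat.
Proof.
apply: crec_ext (crec_iteri (crec_proj 3 0) (crec_proj 3 2)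
  (crec_proj 5 3)) => v _ /=.
by case: (nth 0 v 0).
Qed.

(** This is the step of [CodeSeq.code], by which lists are pickled: the head is the exponent of 2
    and the tail is stored in the odd factor. *)
Definition code_cons n c := 2 ^ n * c.*2.+1.
Definition code_head c := head 0 (CodeSeq.decode c).
Definition code_tail c := CodeSeq.code (behead (CodeSeq.decode c)).

Lemma shr_code i n s : i <= n ->
  shr i (CodeSeq.code (n :: s)) = code_cons (n - i) (CodeSeq.code s).
Proof.
rewrite /shr; elim: i => [|i IH] lin; first by rewrite subn0.
rewrite iterS IH 1?ltnW // /code_cons -[n - i]prednK ?subn_gt0 // -subnS.
by rewrite expnS -mulnA mul2n doubleK.
Qed.

Lemma crec2_cons : crec2 code_cons.
Proof.
apply: crec_ext (crec_app2 crec2_muln (crec_app1 crec1_exp2 (crec_proj 2 0))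
  (crec_succ (crec_app2 crec2_addn (crec_proj 2 1) (crec_proj 2 1)))) => v _ /=.
by rewrite /code_cons addnn.
Qed.

(** The head is the 2-adic valuation, that is, the least [j] such that [j] halvings give an odd
    number. The factor [c] in the minimised function [(1 - odd (shr j c)) * c] stops the search at 0
    for the code 0 of the empty list, where no shift is ever odd. *)
Lemma crec1_head : crec1 code_head.
Proof.
apply: (crec_mu (crec_app2 crec2_muln (crec_app2 crec2_subn (crec_const 2 1)
  (crec_app1 crec1_odd (crec_app2 crec2_shr (crec_proj 2 0) (crec_proj 2 1))))
  (crec_proj 2 1))) => v _ /=.
have [s ->] : exists s, nth 0 v 0 = CodeSeq.code s.
  by exists (CodeSeq.decode (nth 0 v 0)); rewrite CodeSeq.decodeK.
rewrite /code_head CodeSeq.codeK; case: s => [|n s]; first by rewrite muln0.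
rewrite [head 0 _]/= shr_code // subnn /code_cons mul1n /= odd_double mul0n.
split=> // j ltjn; rewrite (shr_code s (ltnW ltjn)).
rewrite oddM oddX subn_eq0 leqNgt ltjn /= mul1n => /eqP.
by rewrite muln_eq0 expn_eq0.
Qed.

(** Once the powers of 2 are removed, the code is twice the tail plus one, and one more halving
    leaves the tail. *)
Lemma crec1_tail : crec1 code_tail.
Proof.
apply: crec_ext (crec_app1 crec1_half (crec_app2 crec2_shr
  (crec_app1 crec1_head (crec_proj 1 0)) (crec_proj 1 0))) => v _ /=.
have [s ->] : exists s, nth 0 v 0 = CodeSeq.code s.
  by exists (CodeSeq.decode (nth 0 v 0)); rewrite CodeSeq.decodeK.
rewrite /code_tail /code_head CodeSeq.codeK; case: s => // n s.
by rewrite shr_code // subnn /code_cons mul1n /= uphalf_double.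
Qed.

(** * Computable functions on countable types *)

Definition computable (A B : countType) (f : A -> B) : Prop :=
  exists g, crec1 g /\ forall x, g (pickle x) = pickle (f x).

Lemma eq_computable (A B : countType) (f g : A -> B) :
  f =1 g -> computable f -> computable g.
Proof. by move=> fg [h [hh hE]]; exists h; split=> // x; rewrite hE fg. Qed.

Lemma computable_id (A : countType) : computable (fun x : A => x).
Proof. by exists id; split=> //; apply: crec_proj. Qed.

Lemma computable_const (A B : countType) (c : B) : computable (fun _ : A => c).
Proof. by exists (fun _ => pickle c); split=> //; apply: crec_const. Qed.

Lemma computable_comp (A B C : countType) (g : B -> C) (f : A -> B) :
  computable g -> computable f -> computable (fun x => g (f x)).
Proof.
move=> [g' [hg gE]] [f' [hf fE]]; exists (fun n => g' (f' n)).
by split=> [|x]; [apply: crec_app1 hg hf|rewrite fE gE].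
Qed.

(** A pair is pickled as a list of two codes; the final 0 is the code of the empty list. *)
Definition code_pair x y := code_cons x (code_cons y 0).

Lemma pickle_pair (A B : countType) (x : A) (y : B) :
  pickle (x, y) = code_pair (pickle x) (pickle y).
Proof. by []. Qed.

Lemma pickle_cons (A : countType) (x : A) s :
  pickle (x :: s) = code_cons (pickle x) (pickle s).
Proof. by []. Qed.

Lemma code_head_cons n c : code_head (code_cons n c) = n.
Proof.
by rewrite /code_head -[c]CodeSeq.decodeK (CodeSeq.codeK (n :: _)).
Qed.

Lemma code_tail_cons n c : code_tail (code_cons n c) = c.
Proof.
rewrite /code_tail -{1}[c]CodeSeq.decodeK.
by rewrite (CodeSeq.codeK (n :: _)) /= CodeSeq.decodeK.
Qed.

Lemma crec_pair k F G :
  crec k F -> crec k G -> crec k (fun v => code_pair (F v) (G v)).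
Proof.
move=> hF hG; apply: (crec_app2 crec2_cons hF).
exact: (crec_app2 crec2_cons hG (crec_const k 0)).
Qed.

Definition code_snd c := code_head (code_tail c).

Lemma crec_snd k F : crec k F -> crec k (fun v => code_snd (F v)).
Proof. by move=> hF; apply: crec_app1 crec1_head (crec_app1 crec1_tail hF). Qed.

Lemma code_snd_pair x y : code_snd (code_pair x y) = y.
Proof. by rewrite /code_snd code_tail_cons code_head_cons. Qed.

Lemma computable_pair (E A B : countType) (f : E -> A) (g : E -> B) :
  computable f -> computable g -> computable (fun e => (f e, g e)).
Proof.
move=> [f' [hf fE]] [g' [hg gE]]; exists (fun n => code_pair (f' n) (g' n)).
by split=> [|x]; [apply: crec_pair|rewrite pickle_pair fE gE].
Qed.

Lemma computable_fst (E A B : countType) (f : E -> A * B) :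
  computable f -> computable (fun e => (f e).1).
Proof.
move=> [f' [hf fE]]; exists (fun n => code_head (f' n)).
split=> [|x]; first exact: crec_app1 crec1_head hf.
by rewrite fE; case: (f x) => a b; rewrite pickle_pair code_head_cons.
Qed.

Lemma computable_snd (E A B : countType) (f : E -> A * B) :
  computable f -> computable (fun e => (f e).2).
Proof.
move=> [f' [hf fE]]; exists (fun n => code_snd (f' n)).
split=> [|x]; first exact: crec_snd.
by rewrite fE; case: (f x) => a b; rewrite pickle_pair code_snd_pair.
Qed.

Lemma computable_comp2 (E A B C : countType) (f : A -> B -> C)
    (g : E -> A) (h : E -> B) :
  computable (fun p : A * B => f p.1 p.2) -> computable g -> computable h ->
  computable (fun e => f (g e) (h e)).
Proof.
by move=> hf hg hh; apply: (computable_comp hf (computable_pair hg hh)).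
Qed.

Lemma computable_if (E B : countType) (b : E -> bool) (f g : E -> B) :
  computable b -> computable f -> computable g ->
  computable (fun e => if b e then f e else g e).
Proof.
move=> [b' [hb bE]] [f' [hf fE]] [g' [hg gE]].
(* The codes of [true] and [false] are 1 and 0, which is what [if_nat] tests. *)
exists (fun n => if_nat (b' n) (f' n) (g' n)).
split=> [|x]; first exact: crec_app3 crec3_if hb hf hg.
by rewrite bE fE gE; case: (b x).
Qed.

Lemma computable_eq (E A : countType) (f g : E -> A) :
  computable f -> computable g -> computable (fun e => f e == g e).
Proof.
move=> [f' [hf fE]] [g' [hg gE]].
exists (fun n => f' n == g' n :> nat).
split=> [|x]; first exact: crec_app2 crec2_eqn hf hg.
rewrite fE gE (inj_eq (pcan_inj pickleK)).
by case: eqP.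
Qed.

(** Makes the code of a list usable as a number of rounds sufficient to consume that list. *)
Lemma size_leq_pickle (A : countType) (s : seq A) : size s <= pickle s.
Proof.
elim: s => //= x s IH; rewrite pickle_cons; apply: leq_ltn_trans IH _.
apply: (@leq_trans (pickle s).*2.+1); first by rewrite ltnS -addnn leq_addr.
by rewrite leq_pmull // expn_gt0.
Qed.

(** The iterated state is the code of a pair: remaining list and accumulator. A round consumes one
    element, or does nothing once the list is empty, so running for as many rounds as the code of
    the list is harmless. *)
Lemma computable_foldl (E A B : countType) (f : E -> B -> A -> B)
    (z : E -> B) (s : E -> seq A) :
  computable (fun p : E * B * A => f p.1.1 p.1.2 p.2) ->
  computable z -> computable s ->
  computable (fun e => foldl (f e) (z e) (s e)).
Proof.
move=> [f' [hf fE]] [z' [hz zE]] [s' [hs sE]].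
pose h e st := if_nat (code_head st)
  (code_pair (code_tail (code_head st))
     (f' (code_pair (code_pair e (code_snd st)) (code_head (code_head st))))) st.
exists (fun n => code_snd (iteri (s' n) (fun _ y => h n y)
                                 (code_pair (s' n) (z' n)))).
split=> [|e].
  apply/crec_snd/(crec_iteri (g := fun v => h (nth 0 v 2) (nth 0 v 1)) hs).
    exact: crec_pair.
  have hst := crec_proj 3 1; have hd := crec_app1 crec1_head hst.
  apply: (crec_app3 crec3_if hd _ hst).
  apply: crec_pair; first exact: crec_app1 crec1_tail hd.
  apply: crec_app1 hf _; apply: crec_pair.
    exact: (crec_pair (crec_proj 3 2) (crec_snd hst)).
  exact: crec_app1 crec1_head hd.
rewrite sE zE.
have -> n x : iteri n (fun _ y => h (pickle e) y) x = iter n (h (pickle e)) x.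
  by elim: n => //= n ->.
have := size_leq_pickle (s e).
suff H n : forall r (y : B), size r <= n ->
    iter n (h (pickle e)) (code_pair (pickle r) (pickle y)) =
    code_pair 0 (pickle (foldl (f e) y r)).
  by move=> /H ->; rewrite code_snd_pair.
elim: n => [|n IH] r y; first by case: r.
case: r => [|x r] lern; rewrite iterSr /h code_head_cons.
  rewrite [if_nat _ _ _]/= -/(h _) /=.
  by have := IH [::] y isT.
rewrite pickle_cons /if_nat ifF; last first.
  by rewrite /code_cons muln_eq0 expn_eq0.
rewrite code_snd_pair code_head_cons code_tail_cons -!pickle_pair fE.
exact: IH.
Qed.

(** * Computable operations on lists and Booleans *)

Lemma computable_cons (E A : countType) (f : E -> A) (g : E -> seq A) :
  computable f -> computable g -> computable (fun e => f e :: g e).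
Proof.
move=> [f' [hf fE]] [g' [hg gE]]; exists (fun n => code_cons (f' n) (g' n)).
by split=> [|x]; [apply: crec_app2 crec2_cons hf hg|rewrite pickle_cons fE gE].
Qed.

Lemma computable_seq1 (E A : countType) (f : E -> A) :
  computable f -> computable (fun e => [:: f e]).
Proof. by move=> hf; apply: computable_cons hf (computable_const _ _). Qed.

Lemma computable_eq_nil (E A : countType) (f : E -> seq A) :
  computable f -> computable (fun e => f e == [::]).
Proof. by move=> hf; apply: computable_eq hf (computable_const _ _). Qed.

Lemma computable_rev (E A : countType) (s : E -> seq A) :
  computable s -> computable (fun e => rev (s e)).
Proof.
move=> hs; apply: (@eq_computable _ _ (fun e => foldl (fun r x => x :: r) [::] (s e))).
  move=> e; rewrite -[rev _]cats0 -catrevE.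
  by elim: (s e) [::] => //= x r IH acc.
apply: (computable_foldl (f := fun _ r x => x :: r)) hs => //.
  apply: computable_cons; first exact/computable_snd/computable_id.
  exact/computable_snd/computable_fst/computable_id.
exact: computable_const.
Qed.

Lemma computable_foldr (E A B : countType) (f : E -> A -> B -> B)
    (z : E -> B) (s : E -> seq A) :
  computable (fun p : E * A * B => f p.1.1 p.1.2 p.2) ->
  computable z -> computable s ->
  computable (fun e => foldr (f e) (z e) (s e)).
Proof.
move=> hf hz hs.
apply: (@eq_computable _ _ (fun e => foldl (fun y x => f e x y) (z e) (rev (s e)))).
  by move=> e; rewrite foldl_rev.
apply: (computable_foldl (f := fun e y x => f e x y)) hz (computable_rev hs).
have id1 := computable_id (E * B * A)%type.
apply: (computable_comp hf (computable_pair (computable_pair _ _) _)).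
- exact/computable_fst/computable_fst.
- exact/computable_snd.
- exact/computable_snd/computable_fst.
Qed.

Lemma computable_map (E A B : countType) (f : E -> A -> B) (s : E -> seq A) :
  computable (fun p : E * A => f p.1 p.2) -> computable s ->
  computable (fun e => [seq f e x | x <- s e]).
Proof.
move=> hf hs.
apply: (computable_foldr (f := fun e x r => f e x :: r)
  (z := fun _ => [::])) hs; last exact: computable_const.
have id1 := computable_id (E * A * seq B)%type.
apply: computable_cons; last exact: computable_snd.
apply: (computable_comp hf); exact: computable_fst.
Qed.

Lemma computable_has (E A : countType) (f : E -> A -> bool) (s : E -> seq A) :
  computable (fun p : E * A => f p.1 p.2) -> computable s ->
  computable (fun e => has (f e) (s e)).
Proof.
move=> hf hs.
apply: (@eq_computable _ _ (fun e =>
  foldr (fun x r => if f e x then true else r) false (s e))).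
  by move=> e; elim: (s e) => //= x r ->; case: ifP.
apply: (computable_foldr (f := fun e x r => if f e x then true else r)
  (z := fun _ => false)) hs; last exact: computable_const.
have id1 := computable_id (E * A * bool)%type.
apply: computable_if; last exact: computable_snd.
  apply: (computable_comp hf); exact: computable_fst.
exact: computable_const.
Qed.

Lemma computable_filter (E A : countType) (f : E -> A -> bool) (s : E -> seq A) :
  computable (fun p : E * A => f p.1 p.2) -> computable s ->
  computable (fun e => [seq x <- s e | f e x]).
Proof.
move=> hf hs.
apply: (@eq_computable _ _ (fun e =>
  foldr (fun x r => if f e x then x :: r else r) [::] (s e))).
  by move=> e; elim: (s e) => //= x r ->.
apply: (computable_foldr (f := fun e x r => if f e x then x :: r else r)
  (z := fun _ => [::])) hs; last exact: computable_const.
have id1 := computable_id (E * A * seq A)%type.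
have hx := computable_fst id1; have hr := computable_snd id1.
apply: computable_if => //; first exact: (computable_comp hf).
by apply: computable_cons => //; apply: computable_snd.
Qed.

Lemma computable_cat (E A : countType) (s t : E -> seq A) :
  computable s -> computable t -> computable (fun e => s e ++ t e).
Proof.
move=> hs ht.
apply: (@eq_computable _ _ (fun e => foldr cons (t e) (s e))).
  by move=> e; elim: (s e) => //= x r ->.
apply: (computable_foldr (f := fun _ => cons)) ht hs.
have id1 := computable_id (E * A * seq A)%type.
apply: computable_cons; last exact: computable_snd.
exact/computable_snd/computable_fst.
Qed.

Lemma computable_flatten (E A : countType) (s : E -> seq (seq A)) :
  computable s -> computable (fun e => flatten (s e)).
Proof.
move=> hs.
apply: (computable_foldr (f := fun _ => cat) (z := fun _ => [::])) hs.
  have id1 := computable_id (E * seq A * seq A)%type.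
  apply: computable_cat; last exact: computable_snd.
  exact/computable_snd/computable_fst.
exact: computable_const.
Qed.

Lemma computable_neg (E : countType) (b : E -> bool) :
  computable b -> computable (fun e => ~~ b e).
Proof.
move=> hb; apply: (@eq_computable _ _ (fun e => if b e then false else true)).
  by move=> e; case: (b e).
by apply: computable_if => //; apply: computable_const.
Qed.

Lemma computable_and (E : countType) (b c : E -> bool) :
  computable b -> computable c -> computable (fun e => b e && c e).
Proof. by move=> hb hc; apply: computable_if => //; apply: computable_const. Qed.

Lemma computable_or (E : countType) (b c : E -> bool) :
  computable b -> computable c -> computable (fun e => b e || c e).
Proof. by move=> hb hc; apply: computable_if => //; apply: computable_const. Qed.

Lemma computable_all (E A : countType) (f : E -> A -> bool) (s : E -> seq A) :
  computable (fun p : E * A => f p.1 p.2) -> computable s ->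
  computable (fun e => all (f e) (s e)).
Proof.
move=> hf hs.
apply: (@eq_computable _ _ (fun e => ~~ has (fun x => ~~ f e x) (s e))).
  by move=> e; rewrite -all_predC; apply: eq_all => x /=; rewrite negbK.
exact/computable_neg/(computable_has (f := fun e x => ~~ f e x))/hs/computable_neg.
Qed.

Lemma computable_mem (E A : countType) (x : E -> A) (s : E -> seq A) :
  computable x -> computable s -> computable (fun e => x e \in s e).
Proof.
move=> hx hs; apply: (@eq_computable _ _ (fun e => has (fun y => y == x e) (s e))).
  by move=> e; rewrite has_pred1.
apply: (computable_has (f := fun e y => y == x e)) hs.
have id1 := computable_id (E * A)%type.
apply: computable_eq; first exact: computable_snd.
exact: (computable_comp hx (computable_fst id1)).
Qed.

Lemma computable_iter (E A : countType) (f : E -> A -> A) (n : E -> nat) (z : E -> A) :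
  computable (fun p : E * A => f p.1 p.2) -> computable n -> computable z ->
  computable (fun e => iter (n e) (f e) (z e)).
Proof.
move=> [f' [hf fE]] [n' [hn nE]] [z' [hz zE]].
exists (fun c => iteri (n' c) (fun _ y => f' (code_pair c y)) (z' c)); split.
  apply: (crec_iteri (g := fun v => f' (code_pair (nth 0 v 2) (nth 0 v 1)))) => //.
  exact/(crec_app1 hf)/crec_pair/crec_proj/crec_proj.
move=> e; rewrite nE zE; set k := pickle (n e).
(* A natural number is its own code. *)
have -> : n e = k by [].
by elim: k => //= k ->; rewrite -pickle_pair fE.
Qed.

(* The codes that are not in the image of [pickle] are why the search is not a
   combinator on [computable], whose witnesses are total on [nat]. *)
Lemma decidable_search (A : countType) (P : A -> Prop) (stop res : A -> nat -> bool) :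
  computable (fun p : A * nat => stop p.1 p.2) ->
  computable (fun p : A * nat => res p.1 p.2) ->
  (forall x, exists n, stop x n) ->
  (forall x n, stop x n -> P x <-> res x n) ->
  decidable_pred P.
Proof.
move=> [s [hs sE]] [r [[pr hr] rE]] exstop Pres.
have [ps hps] : crec 2 (fun v => 1 - s (code_pair (nth 0 v 1) (nth 0 v 0))).
  apply: crec_app2 crec2_subn (crec_const 2 1) (crec_app1 hs _).
  exact: crec_pair (crec_proj 2 1) (crec_proj 2 0).
have [pc hpc] := crec_pair (crec_proj 2 0) (crec_proj 2 1).
(* On a code, [RMu ps] finds the first [n] at which [stop] holds, [pc] pairs the code with it, and
   [pr] evaluates [res] there. *)
exists (RComp pr [:: RComp pc [:: RProj 0; RMu ps]]) => x.
case: (ex_minnP (exstop x)) => n stopn minn.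
have ev : eval (RComp pr [:: RComp pc [:: RProj 0; RMu ps]])
    [:: pickle x] (res x n).
  have -> : nat_of_bool (res x n) = r (pickle (x, n)).
    by rewrite rE; case: (res x n).
  apply: (@ev_comp _ _ _ [:: code_pair (pickle x) n]); last exact: hr.
  apply: evs_cons; last exact: evs_nil.
  apply: (@ev_comp _ _ _ [:: pickle x; n]); last exact: hpc.
  apply: evs_cons; first exact: ev_proj.
  apply: evs_cons; last exact: evs_nil.
  apply: ev_mu => [|k ltkn].
    have := hps [:: n; pickle x] erefl.
    by rewrite /= (sE (x, n)) /= stopn.
  exists 1; split=> //; have := hps [:: k; pickle x] erefl.
  rewrite /= (sE (x, k)) /=.
  by case: (boolP (stop x k)) => // /minn; rewrite leqNgt ltkn.
case: (res x n) (Pres x n stopn) ev => Px ev; split=> hP //.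
  by case: hP; apply/Px.
by move/Px: hP.
Qed.

(** A function on a finite type is a table, compiled into nested equality tests along the
    enumeration. The last default [f b] is never reached; without such a [b] the domain is empty and
    any witness will do. *)
Lemma computable_fin (A : finType) (E B : countType) (f : A -> B) (g : E -> A) :
  computable g -> computable (fun e => f (g e)).
Proof.
move=> hg; apply: (computable_comp (g := f)) hg.
have H s b : computable (fun x : A => foldr (fun a r => if x == a then f a else r) b s).
  elim: s => [|a s IH]; first exact: computable_const.
  apply: computable_if IH; last exact: computable_const.
  exact: computable_eq (computable_id A) (computable_const A a).
case: (pickP A) => [b _|A0]; last first.
  by exists id; split=> [|x]; [exact: crec_proj|have := A0 x].
apply: eq_computable (H (enum A) (f b)) => x.
have: x \in enum A by rewrite mem_enum.
elim: (enum A) => //= a s IH; rewrite inE; case: eqP => [->|_] //=; exact: IH.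
Qed.

(** A finite function is pickled as the list of its values tagged with their arguments, and a tagged
    value has the same code as the corresponding pair. *)
Lemma pickle_ffun n (A : countType) (f : {ffun 'I_n -> A}) :
  pickle f = pickle [seq (i, f i) | i <- enum 'I_n].
Proof.
rewrite [LHS](_ : _ = pickle (codom (total_fun f))) //.
rewrite codomE [LHS]/(CodeSeq.code _) [RHS]/(CodeSeq.code _) -!map_comp.
by [].
Qed.

Lemma computable_ffun n (E A : countType) (f : E -> 'I_n -> A) :
  computable (fun p : E * 'I_n => f p.1 p.2) ->
  computable (fun e => [ffun i => f e i]).
Proof.
move=> hf.
have [g [hg gE]] : computable (fun e => [seq (i, f e i) | i <- enum 'I_n]).
  apply: (computable_map (f := fun e i => (i, f e i))); last exact: computable_const.
  by apply: computable_pair hf; apply/computable_snd/computable_id.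
exists g; split=> // e; rewrite gE pickle_ffun; congr pickle.
by apply: eq_map => i; rewrite ffunE.
Qed.

(** By [pickle_ffun] a function and its graph share one code, so the graph costs nothing, and
    application is a lookup in it. The default [d] is never returned. *)
Lemma computable_app n (E A : countType) (d : A) (f : E -> {ffun 'I_n -> A})
    (i : E -> 'I_n) :
  computable f -> computable i -> computable (fun e => f e (i e)).
Proof.
move=> hf hi.
pose graph (h : {ffun 'I_n -> A}) := [seq (j, h j) | j <- enum 'I_n].
have hgraph : computable graph.
  exists id; split=> [|h]; first exact: crec_proj.
  exact: pickle_ffun.
have id1 := computable_id (E * ('I_n * A) * A)%type.
apply: (@eq_computable _ _ (fun e =>
  foldr (fun p r => if p.1 == i e then p.2 else r) d (graph (f e)))).
  move=> e; rewrite /graph.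
  have: i e \in enum 'I_n by rewrite mem_enum.
  elim: (enum _) => //= j s IH; rewrite inE eq_sym; case: eqP => [->|_] //=.
apply: (computable_foldr (f := fun e p r => if p.1 == i e then p.2 else r)
  (z := fun _ => d)).
- have he := computable_fst id1; apply: computable_if; last exact: computable_snd.
    apply: computable_eq; first exact/computable_fst/computable_snd.
    exact/(computable_comp hi)/computable_fst.
  exact/computable_snd/computable_snd.
- exact: computable_const.
- exact: computable_comp hgraph hf.
Qed.

(** * Synchronizability from almost synchronous traces *)

Section Synchronizability.
Variables (N m : nat) (src dst : 'I_m -> 'I_N).
Hypothesis src_neq_dst : forall a, src a != dst a.
Hypothesis src_of_dst : forall a b, dst a = dst b -> src a = src b.

Implicit Types (S : system N m) (t : seq (action m)) (w u : seq 'I_m).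
Implicit Types (a b : 'I_m) (i j : 'I_N) (p : 'I_N -> nat).

Definition proj i t := [seq x <- t | peer_of src dst x == i].
Definition flat w : seq (action m) :=
  flatten [seq [:: (true, a); (false, a)] | a <- w].

Fixpoint lrun (D : seq (nat * action m * nat)) q t q' : Prop :=
  if t is x :: t then exists r, (q, x, r) \in D /\ lrun D r t q' else q' = q.

(** Channels are deliberately absent: each peer runs its own projection, and the FIFO discipline is
    a separate condition, [crun]. This allows the run of one peer to be exchanged without touching
    the others. *)
Definition reach S t p := forall i, lrun (S i).2 (S i).1 (proj i t) (p i).
Definition sync_reach S w p := reach S (flat w) p.

Definition upd (A : Type) (f : {ffun 'I_N -> A}) j x : {ffun 'I_N -> A} :=
  [ffun k => if k == j then x else f k].

(* All messages to a peer come from the same peer, so that a channel can be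
   named after its receiver. *)
Fixpoint crun (ch : {ffun 'I_N -> seq 'I_m}) t ch' : Prop :=
  match t with
  | [::] => ch' = ch
  | (true, a) :: t => crun (upd ch (dst a) (rcons (ch (dst a)) a)) t ch'
  | (false, a) :: t =>
      exists w, ch (dst a) = a :: w /\ crun (upd ch (dst a) w) t ch'
  end.

Definition norecv j t := all (fun x : action m => x.1 || (dst x.2 != j)) t.

Lemma proj_cat i t1 t2 : proj i (t1 ++ t2) = proj i t1 ++ proj i t2.
Proof. exact: filter_cat. Qed.

Lemma proj_send i a t :
  proj i ((true, a) :: t) = if src a == i then (true, a) :: proj i t else proj i t.
Proof. by []. Qed.

Lemma proj_recv i a t :
  proj i ((false, a) :: t) = if dst a == i then (false, a) :: proj i t else proj i t.
Proof. by []. Qed.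

Lemma flat_cat w1 w2 : flat (w1 ++ w2) = flat w1 ++ flat w2.
Proof. by rewrite /flat map_cat flatten_cat. Qed.

Lemma flat_cons a w : flat (a :: w) = [:: (true, a), (false, a) & flat w].
Proof. by []. Qed.

Lemma sends_cat t1 t2 : sends (t1 ++ t2) = sends t1 ++ sends t2.
Proof. by rewrite /sends filter_cat map_cat. Qed.

Lemma sends_flat w : sends (flat w) = w.
Proof. by elim: w => //= a w IH; rewrite flat_cons /sends /= -/(sends _) IH. Qed.

Lemma sends_flat_send w a t :
  sends (flat w ++ (true, a) :: t) = w ++ a :: sends t.
Proof. by rewrite sends_cat sends_flat. Qed.

Lemma lrun_cat D q t1 t2 q' :
  lrun D q (t1 ++ t2) q' <-> exists r, lrun D q t1 r /\ lrun D r t2 q'.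
Proof.
elim: t1 q => [|x t1 IH] q /=.
  by split=> [H|[r [-> //]]]; exists q.
split=> [[s [sD /IH[r [H1 H2]]]]|[r [[s [sD H1]] H2]]].
  by exists r; split=> //; exists s.
by exists s; split=> //; apply/IH; exists r.
Qed.

Lemma lrun1 D q x q' : lrun D q [:: x] q' <-> (q, x, q') \in D.
Proof. by split=> [[r [rD ->]]|H] //; exists q'. Qed.

Lemma upd_upd (A : Type) (f : {ffun 'I_N -> A}) i x y :
  upd (upd f i x) i y = upd f i y.
Proof. by apply/ffunP=> k; rewrite !ffunE; case: eqP. Qed.

Lemma updC (A : Type) (f : {ffun 'I_N -> A}) i j x y : i != j ->
  upd (upd f i x) j y = upd (upd f j y) i x.
Proof.
move=> /eqP ij; apply/ffunP=> k; rewrite !ffunE.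
by case: eqP => // ->; case: eqP => // /esym.
Qed.

(** By FIFO order, the first reception of [dst a] can only be that of the head [a]. So [a] may be
    removed in advance: either [dst a] receives nothing and its channel ends nonempty, or the
    reception of [a] is deleted from its later place. *)
Lemma crun_advance ch t ch' a w : crun ch t ch' -> ch (dst a) = a :: w ->
  [/\ norecv (dst a) t, ch' (dst a) <> [::]
    & exists ch'', crun (upd ch (dst a) w) t ch''] \/
  exists t1 t2, [/\ t = t1 ++ (false, a) :: t2, norecv (dst a) t1
    & crun (upd ch (dst a) w) (t1 ++ t2) ch'].
Proof.
elim: t ch w => [|[[] b] t IH] ch w /=.
- by move=> -> cha; left; split=> //; [rewrite cha | eexists].
- move=> H cha; case: (eqVneq (dst b) (dst a)) => [eba|nba].
    have := IH _ (rcons w b) H; rewrite ffunE eba eqxx cha /= => /(_ erefl).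
    rewrite !upd_upd !ffunE eqxx.
    case=> [[nr ch'a H']|[t1 [t2 [-> nr H']]]]; first by left.
    by right; exists ((true, b) :: t1), t2; split=> //=; rewrite eba ffunE eqxx upd_upd.
  have := IH _ w H; rewrite ffunE eq_sym (negbTE nba) => /(_ cha).
  rewrite !ffunE (negbTE nba) updC //.
  case=> [[nr ch'a H']|[t1 [t2 [-> nr H']]]]; first by left.
  right; exists ((true, b) :: t1), t2; split=> //=.
  by rewrite ffunE (negbTE nba).
- move=> [v [chb H]] cha; case: (eqVneq (dst b) (dst a)) => [eba|nba].
    right; exists [::], t.
    by move: chb H; rewrite eba cha => -[-> ->] H.
  have := IH _ w H; rewrite ffunE eq_sym (negbTE nba) => /(_ cha).
  rewrite !ffunE (negbTE nba) updC //.
  case=> [[nr ch'a [ch'' H']]|[t1 [t2 [-> nr H']]]].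
    by left; split=> //; exists ch'', v; split.
  right; exists ((false, b) :: t1), t2; split=> //=; first by rewrite nba.
  by exists v; rewrite ffunE (negbTE nba).
Qed.

Lemma proj_norecv j t : norecv j t ->
  exists2 u, proj j t = [seq (true, b) | b <- u] & all (fun b => src b == j) u.
Proof.
elim: t => [|[[] b] t IH] /=; first by exists [::].
  move=> /IH[u -> Hu]; rewrite /peer_of /=; case: (src b =P j) => bj.
    by exists (b :: u) => //=; rewrite bj eqxx.
  by exists u.
by rewrite /peer_of /= => /andP[/negbTE -> /IH].
Qed.

Lemma proj_flat_sends j u : all (fun b => src b == j) u ->
  proj j (flat u) = [seq (true, b) | b <- u].
Proof.
elim: u => // b u IH /andP[/eqP bj /IH ub].
rewrite flat_cons proj_send proj_recv ub /= bj eqxx -[in dst b == j]bj eq_sym.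
by rewrite (negbTE (src_neq_dst b)).
Qed.

(** While [a] or [b] is still in transit no stable configuration is at stake, so some vector [p']
    suffices. After [?a] all channels are empty again and the very same vector has to be reached. *)
Definition almost_sync S : Prop := forall w a u p,
  all (fun b => dst b != dst a) u ->
  reach S (flat w ++ (true, a) :: flat u) p ->
  [/\ exists p', sync_reach S (w ++ a :: u) p',
      forall b q, src b = dst a -> (p (src b), (true, b), q) \in (S (src b)).2 ->
        exists p', sync_reach S (w ++ a :: rcons u b) p'
    & forall q, (p (dst a), (false, a), q) \in (S (dst a)).2 ->
        sync_reach S (w ++ a :: u) (fun k => if k == dst a then q else p k)].

Section Completeness.
Variable S : system N m.
Hypothesis asS : almost_sync S.

Local Notation run_of i := (lrun (S i).2 (S i).1).

(** Only [dst a] can tell whether [a] was received. All other peers have equal projections in both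
    traces, so it suffices to replace the run of [dst a] by one that has not received [a]. *)
Lemma reach_delay w a u p r :
  sync_reach S (w ++ a :: u) p -> all (fun b => src b == dst a) u ->
  run_of (dst a) (proj (dst a) (flat w) ++ [seq (true, b) | b <- u]) r ->
  reach S (flat w ++ (true, a) :: flat u) (fun k => if k == dst a then r else p k).
Proof.
move=> Wp ua Hr k; rewrite proj_cat proj_send /=; case: (k =P _) => [->|/eqP nk].
  by rewrite (negbTE (src_neq_dst a)) (proj_flat_sends ua).
have := Wp k; rewrite flat_cat proj_cat flat_cons proj_send proj_recv.
by rewrite [dst a == k]eq_sym (negbTE nk).
Qed.

Lemma dst_burst a u :
  all (fun b => src b == dst a) u -> all (fun b => dst b != dst a) u.
Proof. by apply: sub_all => b /eqP <-; rewrite eq_sym. Qed.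

(** The burst [u] grows one message at a time: the synchronous trace obtained so far serves all
    peers but [dst a], [reach_delay] puts [dst a] back into a state where [a] is pending, and the
    second clause of [almost_sync] adds the next message. *)
Lemma sync_burst w a u p q r : sync_reach S w p ->
  run_of (src a) (proj (src a) (flat w) ++ [:: (true, a)]) q ->
  all (fun b => src b == dst a) u ->
  run_of (dst a) (proj (dst a) (flat w) ++ [seq (true, b) | b <- u]) r ->
  exists p', sync_reach S (w ++ a :: u) p'.
Proof.
move=> Wp Hq; elim/last_ind: u r => [|u b IH] r.
  (* The sender of [a] has made its move, all others are still where [w] left them. *)
  move=> _ _; have [] // := asS (w := w) (a := a) (u := [::])
    (p := fun k => if k == src a then q else p k) isT.
  move=> k; rewrite proj_cat proj_send /=; case: (k =P _) => [->|/eqP nk].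
    by rewrite eqxx.
  by rewrite eq_sym (negbTE nk) cats0; apply: Wp.
rewrite all_rcons map_rcons -cats1 catA => /andP[/eqP ba ua].
case/lrun_cat=> r0 [Hr0 /lrun1 stepb].
have [p' Wp'] := IH _ ua Hr0.
have [_ /(_ b r ba) + _] := asS (dst_burst ua) (reach_delay Wp' ua Hr0).
by rewrite ba eqxx; apply.
Qed.

(** The third clause of [almost_sync] gives a synchronous trace for [w], [a], [u] ending in the same
    state [r]; in its projection to [dst a], the reception of [a] precedes the burst. *)
Lemma recv_before_burst w a u p q r : sync_reach S w p ->
  run_of (src a) (proj (src a) (flat w) ++ [:: (true, a)]) q ->
  all (fun b => src b == dst a) u ->
  run_of (dst a) (proj (dst a) (flat w) ++ [seq (true, b) | b <- u] ++
                  [:: (false, a)]) r ->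
  run_of (dst a) (proj (dst a) (flat w) ++ (false, a) :: [seq (true, b) | b <- u]) r.
Proof.
move=> Wp Hq ua; rewrite catA => /lrun_cat[r0 [Hr0 /lrun1 stepa]].
have [p' Wp'] := sync_burst Wp Hq ua Hr0.
have [_ _ /(_ r)] := asS (dst_burst ua) (reach_delay Wp' ua Hr0).
rewrite eqxx => /(_ stepa) /(_ (dst a)); rewrite eqxx flat_cat proj_cat flat_cons.
by rewrite proj_send proj_recv (negbTE (src_neq_dst a)) eqxx (proj_flat_sends ua).
Qed.

Lemma reach_cat t1 t2 p : reach S (t1 ++ t2) p ->
  exists p0, reach S t1 p0 /\ forall i, lrun (S i).2 (p0 i) (proj i t2) (p i).
Proof.
move=> H; suff /fin_all_exists[p0 Hp0] : forall i, exists r,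
    run_of i (proj i t1) r /\ lrun (S i).2 r (proj i t2) (p i).
  by exists p0; split=> i; case: (Hp0 i).
by move=> i; apply/lrun_cat; rewrite -proj_cat.
Qed.

Lemma reach_sync_cons w a t p :
  (forall i, i != dst a ->
     run_of i (proj i (flat w) ++ proj i ((true, a) :: t)) (p i)) ->
  run_of (dst a) (proj (dst a) (flat w) ++ (false, a) :: proj (dst a) t) (p (dst a)) ->
  reach S (flat (w ++ [:: a]) ++ t) p.
Proof.
move=> Hi Hj k; rewrite flat_cat -catA /= !proj_cat proj_send proj_recv.
case: (eqVneq k (dst a)) => [->|nk].
  by rewrite (negbTE (src_neq_dst a)).
by have := Hi k nk; rewrite proj_send.
Qed.

(* Peer [dst a] can only send before it receives [a], so recv_before_burst makes
   it receive [a] immediately after its emission, or additionally if [a] is never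
   received; iterating turns the whole trace into a synchronous one. *)
Lemma almost_sync_trace w t p ch :
  reach S (flat w ++ t) p -> crun [ffun=> [::]] t ch ->
  (exists p', sync_reach S (w ++ sends t) p') /\
  ((forall a, ch (dst a) = [::]) -> sync_reach S (w ++ sends t) p).
Proof.
(* Induction on the length: deleting a reception inside the trace does not leave a suffix of it. *)
have [n] := ubnP (size t); elim: n t w p ch => // n IH [|[[] a] t] w p ch.
- by rewrite !cats0 => _ H _; split=> //; exists p.
- rewrite ltnS => ltn H /=; rewrite ffunE /=.
  have [p0 [Wp0 Hp0]] := reach_cat H.
  have [q Hq] : exists q,
      run_of (src a) (proj (src a) (flat w) ++ [:: (true, a)]) q.
    have := H (src a); rewrite proj_cat proj_send eqxx -cat1s catA.
    by case/lrun_cat=> q [Hq _]; exists q.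
  have Hdst := H (dst a).
  rewrite proj_cat proj_send (negbTE (src_neq_dst a)) in Hdst.
  have upd0 : upd (upd [ffun=> [::]] (dst a) [:: a]) (dst a) [::] = [ffun=> [::]].
    by apply/ffunP=> k; rewrite !ffunE; case: eqP.
  move/crun_advance=> /(_ a [::]); rewrite ffunE eqxx => /(_ erefl).
  case=> [[nr cha [ch'']]|].
    rewrite upd0 => Hch; have [u Hu ua] := proj_norecv nr.
    rewrite Hu in Hdst; have [p' Wp'] := sync_burst Wp0 Hq ua Hdst.
    (* Here [a] is never received: [dst a] is given the state it has in the synchronous trace, the
       others keep theirs. The final vector changes, but the channel of [a] ends nonempty, so
       nothing is claimed about it. *)
    have [] := IH t (w ++ [:: a]) (fun k => if k == dst a then p' k else p k) ch''.
    + exact: ltn.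
    + apply: reach_sync_cons => [i /negbTE ni|].
        by rewrite ni -proj_cat; apply: H.
      have := Wp' (dst a); rewrite eqxx flat_cat proj_cat flat_cons proj_send.
      by rewrite proj_recv (negbTE (src_neq_dst a)) eqxx Hu (proj_flat_sends ua).
    + exact: Hch.
    rewrite -catA => ex _; split; first exact: ex.
    by move=> /(_ a).
  move=> [t1 [t2 [tE nr]]]; rewrite upd0 => Hch.
  have [u Hu ua] := proj_norecv nr.
  (* The reception of [a] moves forward past the burst within the run of [dst a] alone; the final
     vector [p] is preserved, as stability requires. *)
  have Hp : reach S (flat (w ++ [:: a]) ++ t1 ++ t2) p.
    apply: reach_sync_cons => [i ni|].
      have := H i; rewrite proj_cat tE !proj_send !proj_cat proj_recv.
      by rewrite [dst a == i]eq_sym (negbTE ni).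
    move: Hdst; rewrite tE !proj_cat proj_recv eqxx Hu -cat1s !catA.
    case/lrun_cat=> r [Hr Hr2].
    have := recv_before_burst Wp0 Hq ua; rewrite catA => /(_ _ Hr) Hr'.
    by rewrite -cat_cons catA; apply/lrun_cat; exists r.
  have -> : w ++ sends ((true, a) :: t) = (w ++ [:: a]) ++ sends (t1 ++ t2).
    by rewrite tE -catA /sends /= !filter_cat.
  apply: IH Hp Hch; apply: leq_ltn_trans (ltn : size t < n).
  by rewrite tE !size_cat leq_add2l /=.
- by move=> _ _ /= [v []]; rewrite ffunE.
Qed.

End Completeness.

(** * Global runs versus local runs *)

Lemma run_cat S c t1 t2 c' :
  run src dst S c (t1 ++ t2) c' <->
  exists c1, run src dst S c t1 c1 /\ run src dst S c1 t2 c'.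
Proof.
split.
  elim: t1 c => [|x t1 IH] c /= H; first by exists c; split=> //; apply: run_nil.
  inversion_clear H as [|? ? c1 ? ? H1 H2]; have [c2 [H3 H4]] := IH _ H2.
  by exists c2; split=> //; apply: run_cons H1 H3.
by case=> c1 [H]; elim: H => //= ? ? ? ? ? H1 _ IH /IH; apply: run_cons.
Qed.

Lemma run_rcons S c t c1 x c2 : run src dst S c t c1 ->
  step src dst S c1 x c2 -> run src dst S c (t ++ [:: x]) c2.
Proof.
move=> H st; apply/run_cat; exists c1; split=> //.
by apply: run_cons st _; apply: run_nil.
Qed.

(** [src_of_dst] enters here: two messages with the same receiver use the same channel, so updating
    the entry of the receiver in [ch] is faithful to the global channels. *)
Lemma run_local S c t c' (ch : {ffun 'I_N -> seq 'I_m}) :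
  run src dst S c t c' -> (forall a, cch c (src a) (dst a) = ch (dst a)) ->
  (forall i, lrun (S i).2 (cst c i) (proj i t) (cst c' i)) /\
  exists ch', crun ch t ch' /\ forall a, cch c' (src a) (dst a) = ch' (dst a).
Proof.
move=> H; elim: H ch => {c t c'} [c|c x c1 t c' st _ IH] ch chE.
  by split=> //; exists ch.
case: st IH => {c x c1} [c a q qD|c a w q cha qD] IH in chE *.
  have [|IH1 [ch' [H1 H2]]] := IH (upd ch (dst a) (rcons (ch (dst a)) a)).
    move=> b; rewrite /= /set_chan ffunE chE; case: (dst b =P dst a) => [e|_].
      by rewrite (src_of_dst e) eqxx.
    by rewrite andbF.
  split=> [i|]; last by exists ch'.
  have := IH1 i; rewrite proj_send /= /set_state; case: (eqVneq i (src a)) => // ->.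
  by exists q.
have [|IH1 [ch' [H1 H2]]] := IH (upd ch (dst a) w).
  move=> b; rewrite /= /set_chan ffunE; case: (dst b =P dst a) => [e|_].
    by rewrite (src_of_dst e) eqxx.
  by rewrite andbF.
split=> [i|]; last by exists ch'; split=> //; exists w; rewrite -chE.
have := IH1 i; rewrite proj_recv /= /set_state; case: (eqVneq i (dst a)) => // ->.
by exists q.
Qed.

Lemma sync_run S c w p :
  (forall i, lrun (S i).2 (cst c i) (proj i (flat w)) (p i)) ->
  all (fun b => nilp (cch c (src b) (dst b))) w ->
  run src dst S c (flat w) (Config p (cch c)).
Proof.
elim: w c => [|a w IH] [cs cc] H.
  move=> _; have -> : p = cs by apply: functional_extensionality => i; apply: (H i).
  exact: run_nil.
move=> /andP[/nilP /= cca ccw].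
have := H (src a); rewrite proj_send proj_recv eqxx.
rewrite eq_sym (negbTE (src_neq_dst a)) => -[r [rD Hr]].
have := H (dst a); rewrite proj_send proj_recv eqxx.
rewrite (negbTE (src_neq_dst a)) => -[s [sD Hs]].
rewrite flat_cons; apply: run_cons (step_send dst (q' := r) _) _ => //.
apply: run_cons (step_recv (w := [::]) (q' := s) _ _) _ => /=.
- by rewrite /set_chan /= !eqxx cca.
- by rewrite /set_state /= eq_sym (negbTE (src_neq_dst a)).
set c2 := Config _ _; have ccE : cch c2 = cc.
  do 2 apply: functional_extensionality => ?; rewrite /= /set_chan /=.
  by case: andP => // -[/eqP -> /eqP ->].
rewrite -[cc in Config p cc]ccE; apply: IH; last by rewrite ccE.
move=> i; have := H i; rewrite proj_send proj_recv /c2 /= /set_state /=.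
case: (eqVneq i (dst a)) => [->|_] //.
case: (eqVneq i (src a)) => [->|_] //.
Qed.

Lemma sync_reach_run S w p :
  sync_reach S w p -> run src dst S (c0 S) (flat w) (Config p (fun _ _ => [::])).
Proof.
by move=> H; apply: (sync_run (c := c0 S)) => //; apply/allP.
Qed.

Lemma run_reach S t c : run src dst S (c0 S) t c ->
  reach S t (cst c) /\
  exists ch, crun [ffun=> [::]] t ch /\ forall a, cch c (src a) (dst a) = ch (dst a).
Proof. by move=> /run_local; apply=> a; rewrite ffunE. Qed.

Lemma pending_run S w a u p : all (fun b => dst b != dst a) u ->
  reach S (flat w ++ (true, a) :: flat u) p ->
  run src dst S (c0 S) (flat w ++ (true, a) :: flat u)
    (Config p (set_chan (c0 S) (src a) (dst a) [:: a])).
Proof.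
move=> ua /reach_cat[p0 [/sync_reach_run Hw Hu]]; apply/run_cat.
eexists; split; first exact: Hw.
have := Hu (src a); rewrite proj_send eqxx => -[r [rD Hr]].
apply: run_cons (step_send dst (q' := r) _) _ => //.
apply: (sync_run (c := Config _ _)) => /= [i|].
  have := Hu i; rewrite proj_send /set_state; case: (eqVneq i (src a)) => // ->.
  by [].
apply: sub_all ua => b ba; rewrite /set_chan /=.
by rewrite (negbTE ba) andbF.
Qed.

(** Conservation law of a FIFO channel; it makes [buf] defined along every run and bounds its length
    by the number of emissions. *)
Lemma run_chan S c t c' i j : run src dst S c t c' ->
  cch c i j ++ sent_on src dst i j t = recv_on src dst i j t ++ cch c' i j.
Proof.
elim=> {c t c'} [c|c x c1 t c' st _ IH]; first by rewrite cats0.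
case: st IH => {c x c1} [c a q qD|c a w q cha qD];
  rewrite /sent_on /recv_on /= /set_chan ![_ == i]eq_sym ![_ == j]eq_sym.
  by case: ifP => [/andP[/eqP -> /eqP ->]|_] //=; rewrite cat_rcons.
by case: ifP => [/andP[/eqP -> /eqP ->]|_] //= <-; rewrite cha.
Qed.

Lemma run_Tomega S t c : run src dst S (c0 S) t c -> Tomega src dst S t.
Proof.
(* The successor keeps the bound positive, because [T 0] means synchronous traces. *)
move=> H; exists (size t).+1; split; last by exists c.
move=> n i j; move: H; rewrite -{1}[t](cat_take_drop n) => /run_cat[c1 [H _]].
have := run_chan i j H; rewrite /buf /= => ->.
rewrite prefix_prefix drop_size_cat //; eexists; split; first by [].
have := congr1 size (run_chan i j H); rewrite !size_cat add0n.
move=> sz; apply: (@leq_trans (size (sent_on src dst i j (take n t)))).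
  by rewrite sz leq_addl.
rewrite /sent_on size_map size_filter (leq_trans (count_size _ _)) //.
by rewrite size_take_min (leq_trans (geq_minr _ _)).
Qed.

(** A synchronous trace is determined by its sends, so the one provided by synchronizability is
    [flat (sends t)]. *)
Lemma synchronizable_run S t c : synchronizable src dst S ->
  run src dst S (c0 S) t c ->
  (exists p, sync_reach S (sends t) p) /\
  (stable c -> sync_reach S (sends t) (cst c)).
Proof.
move=> syn H; split=> [|stc].
  have [_] := syn (inl (sends t)); case; first by exists t; split=> //; apply: run_Tomega H.
  move=> t' [[[w ->] [c' /run_reach[Hr _]]]]; rewrite -/(flat w) sends_flat => <-.
  by exists (cst c').
have [_] := syn (inr (sends t, c)); case.
  by exists t; split=> //; apply: run_Tomega H.
move=> t' [[[w ->] _] [/run_reach[Hr _] [_]]].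
by rewrite -/(flat w) sends_flat => <-.
Qed.

Lemma synchronizable_almost_sync S : synchronizable src dst S -> almost_sync S.
Proof.
move=> syn w a u p ua Hp; have Hrun := pending_run ua Hp.
split=> [|b q ba qD|q qD].
- have [[p' Hp'] _] := synchronizable_run syn Hrun.
  by exists p'; rewrite sends_flat_send sends_flat in Hp'.
- have H := run_rcons Hrun (step_send dst (c := Config p _) qD).
  have [[p' Hp'] _] := synchronizable_run syn H.
  exists p'; move: Hp'; rewrite -catA /= sends_flat_send sends_cat sends_flat.
  by rewrite cats1.
have chan_a : set_chan (c0 S) (src a) (dst a) [:: a] (src a) (dst a) = [:: a].
  by rewrite /set_chan !eqxx.
have H := run_rcons Hrun (step_recv (c := Config p _) chan_a qD).
have [_ Hst] := synchronizable_run syn H.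
move: Hst; rewrite -catA /= sends_flat_send sends_cat sends_flat cats0; apply.
move=> i j; rewrite /= /set_chan /=; case: ifP => // ->.
by [].
Qed.

Lemma almost_sync_synchronizable S : almost_sync S -> synchronizable src dst S.
Proof.
move=> asS x; split.
  by case: x => [w [t [Ht <-]]|[w c] [t [Ht H]]]; exists t; split=> //; exists 0.
have syncT w p : sync_reach S w p -> T src dst 0 S (flat w).
  by move=> /sync_reach_run H; split; [exists w | eexists; exact: H].
case: x => [w [t [[k [_ [c H]]] <-]]|[w c] [t [_ [H [stc <-]]]]].
  have [Hr [ch [Hch _]]] := run_reach H.
  have [[p Hp] _] := almost_sync_trace asS (w := [::]) Hr Hch.
  by exists (flat (sends t)); rewrite sends_flat; split=> //; apply: syncT Hp.
have [Hr [ch [Hch chE]]] := run_reach H.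
have [_ Hp] := almost_sync_trace asS (w := [::]) Hr Hch.
have {}Hp := Hp (fun a => etrans (esym (chE a)) (stc _ _)).
exists (flat (sends t)); rewrite sends_flat; split; first exact: syncT Hp.
split; last by [].
have -> : c = Config (cst c) (fun _ _ => [::]); last exact: sync_reach_run.
case: c stc {H Hr chE Hp} => cs cc /= stc; congr Config.
by do 2 apply: functional_extensionality => ?; apply: stc.
Qed.

End Synchronizability.

(** * Exploration of the almost synchronous traces *)

(** As long as a stage is not closed, the next one has a new element; inside the finite list [A]
    this can happen at most [size A] times. *)
Lemma iter_closes (X : eqType) (next : X -> seq X) (L A : seq X) :
  (forall n, {subset iter n (fun L => L ++ flatten (map next L)) L <= A}) ->
  exists n, let R := iter n (fun L => L ++ flatten (map next L)) L in
    all [in R] (flatten (map next R)).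
Proof.
pose R n := iter n (fun L => L ++ flatten (map next L)) L; move=> RA.
suff H n : (exists n', all [in R n'] (flatten (map next (R n')))) \/
    n <= size (undup (R n)).
  have [//|] := H (size A).+1; rewrite leqNgt ltnS uniq_leq_size ?undup_uniq //.
  by move=> x; rewrite mem_undup; apply: RA.
elim: n => [|n [IH|IH]]; [by right|by left|].
have [?|/allPn[y yn yR]] := boolP (all [in R n] (flatten (map next (R n)))).
  by left; exists n.
right; apply: leq_ltn_trans IH _.
apply: (@uniq_leq_size _ (y :: undup (R n))).
  by rewrite /= undup_uniq mem_undup yR.
move=> x; rewrite inE !mem_undup /= mem_cat => /predU1P[->|->] //.
by rewrite yn orbT.
Qed.

Section Exploration.
Variables (N m : nat) (src dst : 'I_m -> 'I_N).
Implicit Types (S : system N m) (t : seq (action m)) (w u : seq 'I_m).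
Implicit Types (a b : 'I_m) (i j : 'I_N) (x : action m).

Local Notation Q := {ffun 'I_N -> nat}.
Implicit Types (p : Q) (D : seq Q).

Definition init S : Q := [ffun i => (S i).1].

Definition states S : seq nat :=
  flatten [seq (S i).1 :: [seq d.2 | d <- (S i).2] | i <- enum 'I_N].

(** The power of [states S] over all peers, one coordinate per round of the fold; [init S] is only a
    starting value to be overwritten. [states] merges the states of all peers, a harmless
    overestimate. *)
Definition vectors S : seq Q :=
  foldr (fun i L => flatten [seq [seq upd p i q | q <- states S] | p <- L])
    [:: init S] (enum 'I_N).

Definition move1 S x p p' :=
  let i := peer_of src dst x in
  ((p i, x, p' i) \in (S i).2) && all (fun j => (j == i) || (p j == p' j)) (enum 'I_N).

(** Filtering the fixed list [vectors S] makes each result a sublist of it given by a mask, so that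
    only finitely many sets occur. *)
Definition post S x D := [seq p' <- vectors S | has (fun p => move1 S x p p') D].

Definition post2 S a D := post S (false, a) (post S (true, a) D).

Definition det S w := foldl (fun D a => post2 S a D) [:: init S] w.

(* Nodes consist of the control states, the message in transit (if any), and
   the control states reached by the synchronous trace with the same sends. *)
Definition node := (Q * seq 'I_m * seq Q)%type.

(** Even when [a] is only sent, the last component advances by the whole exchange [post2]: it
    follows the synchronous trace with the same sends. *)
Definition successors S (nd : node) : seq node :=
  flatten [seq
    (if all (fun b => dst a != dst b) nd.1.2
     then [seq (p, nd.1.2, post2 S a nd.2) | p <- post2 S a [:: nd.1.1]] else [::]) ++
    (if nd.1.2 == [::]
     then [seq (p, [:: a], post2 S a nd.2) | p <- post S (true, a) [:: nd.1.1]]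
     else [::]) | a <- enum 'I_m].

Definition explored S n : seq node :=
  iter n (fun L => L ++ flatten [seq successors S nd | nd <- L])
    [:: (init S, [::], [:: init S])].

(** The three disjuncts negate the three clauses of [almost_sync]; nodes with nothing in transit are
    never bad. *)
Definition bad S (nd : node) :=
  has (fun a =>
    [|| nd.2 == [::],
        has (fun b => [&& src b == dst a, post S (true, b) [:: nd.1.1] != [::]
                        & post2 S b nd.2 == [::]]) (enum 'I_m)
      | has (fun p => p \notin nd.2) (post S (false, a) [:: nd.1.1])]) nd.1.2.

(** * Correctness of the exploration *)

Lemma upd_id (p : Q) i q : p i = q -> upd p i q = p.
Proof. by move=> pi; apply/ffunP=> k; rewrite ffunE; case: eqP => // ->. Qed.

Lemma mem_vectors S p : (forall i, p i \in states S) -> p \in vectors S.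
Proof.
(* Invariant for the fold: outside the coordinates treated so far, the vector is initial. *)
rewrite /vectors; have : forall i, i \notin enum 'I_N -> p i = (S i).1.
  by move=> i; rewrite mem_enum.
elim: (enum 'I_N) p => [|i s IH] p ps pS /=.
  by rewrite inE; apply/eqP/ffunP=> i; rewrite ps // ffunE.
have initS : (S i).1 \in states S.
  apply/flatten_mapP; exists i; first by rewrite mem_enum.
  by rewrite inE eqxx.
apply/flatten_mapP; exists (upd p i (S i).1).
  apply: IH => k; rewrite ffunE; case: (k =P i) => [ki|/eqP ki]; rewrite ?ki //.
  by move=> ks; apply: ps; rewrite inE negb_or ki.
apply/mapP; exists (p i); first exact: pS.
by rewrite upd_upd upd_id.
Qed.

Lemma reach_vectors S t p : reach src dst S t p -> p \in vectors S.
Proof.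
move=> H; apply: mem_vectors => i; apply/flatten_mapP.
exists i; first by rewrite mem_enum.
suff {H} G (D : seq (nat * action m * nat)) q q' s :
    lrun D q s q' -> q' \in q :: [seq d.2 | d <- D] by exact: G (H i).
elim: s q => [|x s IH] q /=; first by move->; rewrite inE eqxx.
move=> [r [rD /IH]]; rewrite !inE => /predU1P[->|->]; last by rewrite orbT.
by apply/orP; right; apply/mapP; exists (q, x, r).
Qed.

Lemma eq_reach S t (f g : 'I_N -> nat) : f =1 g ->
  reach src dst S t f -> reach src dst S t g.
Proof. by move=> fg H i; rewrite -fg. Qed.

Lemma reach_rcons S t x p' : reach src dst S (t ++ [:: x]) p' <->
  exists p, reach src dst S t p /\ move1 S x p p'.
Proof.
split=> [/reach_cat[p0 [H0 H1]]|[p [H /andP[pD /allP pp']]] i].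
  exists [ffun i => p0 i]; split; first by apply: eq_reach H0 => i; rewrite ffunE.
  apply/andP; split.
    by have := H1 (peer_of src dst x); rewrite /proj /= eqxx ffunE => /lrun1.
  apply/allP=> j _; have := H1 j; rewrite /proj /= [_ == j]eq_sym ffunE.
  by case: (j =P _) => //= _ ->.
rewrite proj_cat /proj /=; case: eqP => [ix|/eqP xi].
  by apply/lrun_cat; exists (p i); split; [exact: H|apply/lrun1; rewrite -ix].
rewrite cats0; have := pp' i; rewrite mem_enum [i == _]eq_sym (negbTE xi).
by move=> /(_ isT) /eqP <-; apply: H.
Qed.

Lemma post_sound S x D t p' : (forall p, p \in D -> reach src dst S t p) ->
  p' \in post S x D -> reach src dst S (t ++ [:: x]) p'.
Proof.
move=> DE; rewrite mem_filter => /andP[/hasP[p /DE Hp Hm] _].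
by apply/reach_rcons; exists p.
Qed.

(** The predecessor is chosen before [D], so the lemma applies both to a singleton, for the control
    vector of a node, and to the sets of the subset construction. *)
Lemma post_complete S x t p' : reach src dst S (t ++ [:: x]) p' ->
  exists p, reach src dst S t p /\ forall D, p \in D -> p' \in post S x D.
Proof.
move=> Hp'; have /reach_rcons[p [Hp Hm]] := Hp'; exists p; split=> // D pD.
by rewrite mem_filter (reach_vectors Hp') andbT; apply/hasP; exists p.
Qed.

Lemma mem_post1 S x t p q : reach src dst S t p ->
  (p (peer_of src dst x), x, q) \in (S (peer_of src dst x)).2 ->
  upd p (peer_of src dst x) q \in post S x [:: p].
Proof.
move=> Hp qD; have Hm : move1 S x p (upd p (peer_of src dst x) q).
  rewrite /move1 ffunE eqxx qD; apply/allP=> i _; rewrite ffunE.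
  by case: (i == _); rewrite /= ?eqxx.
rewrite mem_filter has_seq1 Hm; apply: (@reach_vectors _ (t ++ [:: x])).
by apply/reach_rcons; exists p.
Qed.

Lemma post2_sound S a D t p' : (forall p, p \in D -> reach src dst S t p) ->
  p' \in post2 S a D -> reach src dst S (t ++ flat [:: a]) p'.
Proof.
rewrite -[flat _]/([:: (true, a)] ++ [:: (false, a)]) catA => DE.
by apply: post_sound => p; apply: post_sound.
Qed.

Lemma post2_complete S a t p' : reach src dst S (t ++ flat [:: a]) p' ->
  exists p, reach src dst S t p /\ forall D, p \in D -> p' \in post2 S a D.
Proof.
rewrite -[flat _]/([:: (true, a)] ++ [:: (false, a)]) catA.
case/post_complete=> q [/post_complete[p [Hp HD]] Hq].
by exists p; split=> // D /HD; apply: Hq.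
Qed.

Lemma det_cat1 S w a : det S (w ++ [:: a]) = post2 S a (det S w).
Proof. by rewrite /det foldl_cat. Qed.

Lemma mem_det S w p : p \in det S w <-> sync_reach src dst S w p.
Proof.
elim/last_ind: w p => [|w a IH] p.
  rewrite inE; split=> [/eqP -> i|H]; first by rewrite ffunE.
  by apply/eqP/ffunP=> i; rewrite ffunE; apply: (H i).
rewrite -cats1 det_cat1 /sync_reach flat_cat; split.
  by apply: post2_sound => q /IH.
by case/post2_complete=> q [/IH Hq]; apply.
Qed.

(** Traces grown at the right end exactly as [successors] extends nodes; [pending_traceP] and
    [pending_trace_flat] relate them to the shape used in [almost_sync]. *)
Inductive pending_trace : seq (action m) -> seq 'I_m -> Prop :=
| pending_nil : pending_trace [::] [::]
| pending_sync t e a : pending_trace t e -> all (fun b => dst a != dst b) e ->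
    pending_trace (t ++ flat [:: a]) e
| pending_send t a : pending_trace t [::] -> pending_trace (t ++ [:: (true, a)]) [:: a].

Lemma pending_traceP t e : pending_trace t e ->
  match e with
  | [::] => exists w, t = flat w
  | [:: a] => exists w u, t = flat w ++ (true, a) :: flat u /\
                          all (fun b => dst b != dst a) u
  | _ => False
  end.
Proof.
elim=> {t e} [|t e a _ IH ae|t a _ [w ->]].
- by exists [::].
- case: e IH ae => [[w ->] _|b [[w [u [-> ub]]] /=|]] //.
    by exists (w ++ [:: a]); rewrite flat_cat.
  rewrite andbT => ab; exists w, (u ++ [:: a]).
  by rewrite flat_cat -catA all_cat ub /= ab.
by exists w, [::].
Qed.

Lemma pending_flat w : pending_trace (flat w) [::].
Proof.
elim/last_ind: w => [|w a IH]; first exact: pending_nil.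
by rewrite -cats1 flat_cat; apply: pending_sync.
Qed.

Lemma pending_trace_flat w a u : all (fun b => dst b != dst a) u ->
  pending_trace (flat w ++ (true, a) :: flat u) [:: a].
Proof.
elim/last_ind: u => [|u b IH].
  by move=> _; apply: pending_send; apply: pending_flat.
rewrite all_rcons => /andP[ba /IH H].
rewrite -cats1 flat_cat -cat_cons catA; apply: pending_sync H _.
by rewrite /= ba.
Qed.

Lemma explored_sound S n nd : nd \in explored S n ->
  exists t, [/\ pending_trace t nd.1.2, reach src dst S t nd.1.1
              & nd.2 = det S (sends t)].
Proof.
elim: n nd => [|n IH] nd.
  rewrite inE => /eqP ->; exists [::]; split=> //; first exact: pending_nil.
  by move=> i; rewrite /= ffunE.
rewrite /explored iterS -/(explored S n) mem_cat => /orP[/IH //|].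
case/flatten_mapP=> -[[p e] D] /IH[t [/= Ht Hp ->]] {IH}.
case/flatten_mapP=> a _; rewrite mem_cat /= => /orP[].
  case: ifP => // ae /mapP[p' Hp' ->] /=; exists (t ++ flat [:: a]); split.
  - exact: pending_sync.
  - by apply: post2_sound Hp' => q; rewrite inE => /eqP ->.
  - by rewrite sends_cat det_cat1.
case: eqP Ht => // -> Ht /mapP[p' Hp' ->] /=; exists (t ++ [:: (true, a)]); split.
- exact: pending_send.
- by apply: post_sound Hp' => q; rewrite inE => /eqP ->.
- by rewrite sends_cat det_cat1.
Qed.

Lemma explored_complete S t e p : pending_trace t e -> reach src dst S t p ->
  exists n, (p, e, det S (sends t)) \in explored S n.
Proof.
move=> Ht; elim: Ht p => {t e} [|t e a _ IH ae|t a _ IH] p.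
- move=> H; exists 0; rewrite inE (_ : p = init S) //.
  by apply/ffunP=> i; rewrite ffunE; apply: (H i).
- case/post2_complete=> q [/IH[n Hn] /(_ [:: q]) Hp]; exists n.+1.
  rewrite /explored iterS -/(explored S n) mem_cat; apply/orP; right.
  apply/flatten_mapP; exists (q, e, det S (sends t)) => //.
  apply/flatten_mapP; exists a; first by rewrite mem_enum.
  rewrite mem_cat /= ae sends_cat det_cat1; apply/orP; left.
  by apply/mapP; exists p => //; apply: Hp; rewrite inE.
case/post_complete=> q [/IH[n Hn] /(_ [:: q]) Hp]; exists n.+1.
rewrite /explored iterS -/(explored S n) mem_cat; apply/orP; right.
apply/flatten_mapP; exists (q, [::], det S (sends t)) => //.
apply/flatten_mapP; exists a; first by rewrite mem_enum.
rewrite mem_cat sends_cat det_cat1; apply/orP; right.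
by apply/mapP; exists p => //; apply: Hp; rewrite inE.
Qed.

Lemma det_neq0 S w :
  det S w != [::] <-> exists p : 'I_N -> nat, sync_reach src dst S w p.
Proof.
split=> [|[p Hp]].
  case E: (det S w) => [|p D] // _; exists (fun i => p i).
  by apply/mem_det; rewrite E inE eqxx.
have: [ffun i => p i] \in det S w.
  by apply/mem_det; apply: eq_reach Hp => i; rewrite ffunE.
by case: (det S w).
Qed.

(** By [mem_det], the last component of a node turns existence of a synchronous trace into
    nonemptiness, and reaching a given vector into membership. *)
Lemma almost_sync_explored S :
  almost_sync src dst S <-> forall n, ~~ has (bad S) (explored S n).
Proof.
split=> [asS n|nbad w a u f ua Hf].
  apply/hasPn => -[[p e] D] /explored_sound[t [/= Ht Hp ->]].
  apply/hasPn => a /=; case: e Ht => [|c [|? ?]] /pending_traceP // [w [u [tE uc]]].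
  rewrite inE => /eqP ac; subst c t.
  have [det1 det2 det3] := asS _ _ _ _ uc Hp.
  rewrite sends_flat_send sends_flat.
  rewrite !negb_or; apply/and3P; split; first by apply/det_neq0; apply: det1.
    apply/hasPn => b _; apply/and3P => -[/eqP ba].
    case E: (post _ _ _) => [|q s] // _.
    have: q \in post S (true, b) [:: p] by rewrite E inE eqxx.
    rewrite mem_filter has_seq1 => /andP[/andP[pq _] _].
    rewrite -det_cat1 -catA cat_cons cats1.
    by apply/negP/det_neq0; apply: det2 pq.
  apply/hasPn => q; rewrite mem_filter has_seq1 negbK => /andP[/andP[pq /allP eqpq] _].
  apply/mem_det; apply: eq_reach (det3 _ pq) => k.
  have := eqpq k; rewrite mem_enum => /(_ isT).
  by case: (k =P _) => [->|_ /eqP].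
have [p pf] : exists p : Q, p =1 f.
  by exists [ffun i => f i] => i; rewrite ffunE.
have Hp : reach src dst S (flat w ++ (true, a) :: flat u) p.
  by apply: eq_reach Hf => i; rewrite pf.
have [n Hn] := explored_complete (pending_trace_flat w ua) Hp.
have := hasPn (nbad n) _ Hn; rewrite /bad /= orbF !negb_or.
rewrite sends_flat_send sends_flat.
case/and3P=> /det_neq0 ex /hasPn exb /hasPn exr.
split=> // [b q ba bD|q aD].
  rewrite -pf in bD; have Hp' := mem_post1 (x := (true, b)) Hp bD.
  have := exb b; rewrite mem_enum ba eqxx => /(_ isT) /=.
  case: (post _ _ _) Hp' => //= _ _ _.
  by rewrite -det_cat1 -catA cat_cons cats1 => /det_neq0.
rewrite -pf in aD; have Hp' := mem_post1 (x := (false, a)) Hp aD.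
have := exr _ Hp'; rewrite negbK => /mem_det; apply: eq_reach => k.
by rewrite ffunE pf.
Qed.

End Exploration.

(** * Termination and computability of the exploration *)

Section Decision.
Variables (N m : nat) (src dst : 'I_m -> 'I_N).
Implicit Types (S : system N m).

Local Notation Q := {ffun 'I_N -> nat}.

(** One closed stage contains all others, so inspecting it for bad nodes settles the question for
    every stage. *)
Lemma explored_closed S n k :
  all [in explored src dst S n]
    (flatten [seq successors src dst S nd | nd <- explored src dst S n]) ->
  {subset explored src dst S k <= explored src dst S n}.
Proof.
move=> /allP cl; elim: k => [|k IH] nd.
  by elim: n {cl} => // n IH /IH; rewrite /explored iterS mem_cat => ->.
rewrite {1}/explored iterS -/(explored _ _ S k) mem_cat => /orP[/IH //|].
case/flatten_mapP=> nd' /IH nd'n ndS; apply: cl.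
by apply/flatten_mapP; exists nd'.
Qed.

(** All nodes lie in a finite product: a vector, at most one message, and a sublist of [vectors S]
    described by a Boolean mask. *)
Lemma explored_closes S : exists n,
  all [in explored src dst S n]
    (flatten [seq successors src dst S nd | nd <- explored src dst S n]).
Proof.
(* The set of the empty word is listed apart, as it does not arise from a filter of [vectors S]. *)
pose Ds := [:: init S] ::
  [seq mask (val b) (vectors S) | b <- enum {: (size (vectors S)).-tuple bool}].
pose es := [::] :: [seq [:: a] | a <- enum 'I_m].
apply: (@iter_closes _ _ _
  [seq (pe, D) | pe <- [seq (p, e) | p <- vectors S, e <- es], D <- Ds]).
move=> n [[p e] D] /explored_sound[t [/pending_traceP Ht Hp]].
move=> DE; rewrite [(p, e, D)]surjective_pairing DE; apply/allpairsPdep.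
exists (p, e), (det src dst S (sends t)); split=> //.
  apply/allpairsPdep; exists p, e; split=> //; first exact: reach_vectors Hp.
  case: e Ht {Hp DE} => [|a [|? ?]] // _; rewrite inE //=.
  by apply/mapP; exists a; rewrite ?mem_enum.
case/lastP: (sends t) => [|w a]; first by rewrite inE eqxx.
rewrite -cats1 det_cat1 /post2 {1}/post filter_mask inE; apply/orP; right.
set b := map _ (vectors S); have bP : size b == size (vectors S) by rewrite size_map.
by apply/mapP; exists (Tuple bP); rewrite ?mem_enum.
Qed.

Ltac projections :=
  repeat first [exact: computable_id | apply: computable_fst | apply: computable_snd].

Lemma computable_system (E : countType) (f : E -> system N m) (i : E -> 'I_N) :
  computable f -> computable i -> computable (fun e => f e (i e)).
Proof. exact: computable_app (0, [::]) _ _. Qed.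

Lemma computable_init : computable (@init N m).
Proof.
apply: (computable_ffun (f := fun S i => (S i).1)).
apply: computable_fst; apply: computable_system; projections.
Qed.

Lemma computable_upd (E : countType) (f : E -> Q) i q :
  computable f -> computable i -> computable q ->
  computable (fun e => upd (f e) (i e) (q e)).
Proof.
move=> hf hi hq.
have id1 := computable_id (E * 'I_N)%type; have he := computable_fst id1.
apply: (computable_ffun (f := fun e k => if k == i e then q e else f e k)).
apply: computable_if.
- by apply: computable_eq; [projections|apply: computable_comp hi he].
- exact: computable_comp hq he.
- by apply: (computable_app 0); [apply: computable_comp hf he|projections].
Qed.

Lemma computable_states : computable (@states N m).
Proof.
apply: computable_flatten.
apply: (computable_map (f := fun S i => (S i).1 :: [seq d.2 | d <- (S i).2]));
  last exact: computable_const.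
have hS : computable (fun e : system N m * 'I_N => e.1 e.2).
  by apply: computable_system; projections.
apply: computable_cons; first exact: computable_fst.
apply: (computable_map (f := fun _ d => d.2)); first by projections.
exact: computable_snd.
Qed.

Lemma computable_vectors : computable (@vectors N m).
Proof.
apply: (computable_foldr (f := fun S i L =>
  flatten [seq [seq upd p i q | q <- states S] | p <- L])
  (z := fun S => [:: init S]) (s := fun _ => enum 'I_N)).
- apply: computable_flatten.
  apply: (computable_map (f := fun e p => [seq upd p e.1.2 q | q <- states e.1.1]));
    last by projections.
  apply: (computable_map (f := fun e q => upd e.2 e.1.1.2 q)).
    by apply: computable_upd; projections.
  by apply: computable_comp computable_states _; projections.
- apply: computable_cons; first exact: computable_init.
  exact: computable_const.
- exact: computable_const.
Qed.

Lemma computable_move1 (E : countType) (S : E -> system N m) x p p' :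
  computable S -> computable x -> computable p -> computable p' ->
  computable (fun e => move1 src dst (S e) (x e) (p e) (p' e)).
Proof.
move=> hS hx hp hp'.
have hi := computable_fin (peer_of src dst) hx.
have hpi := computable_app 0 hp hi; have hpi' := computable_app 0 hp' hi.
apply: computable_and.
  apply: computable_mem; last exact/computable_snd/computable_system.
  exact: computable_pair (computable_pair hpi hx) hpi'.
apply: (computable_all (f := fun e j =>
  (j == peer_of src dst (x e)) || (p e j == p' e j))); last exact: computable_const.
have he : computable (fun e : E * 'I_N => e.1) by projections.
have hj : computable (fun e : E * 'I_N => e.2) by projections.
apply: computable_or; first exact: computable_eq hj (computable_comp hi he).
apply: computable_eq; apply: (computable_app 0) hj; exact: computable_comp he.
Qed.

Lemma computable_post (E : countType) (S : E -> system N m) x D :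
  computable S -> computable x -> computable D ->
  computable (fun e => post src dst (S e) (x e) (D e)).
Proof.
move=> hS hx hD.
apply: (computable_filter (f := fun e p' =>
  has (fun p => move1 src dst (S e) (x e) p p') (D e)));
  last exact: computable_comp computable_vectors hS.
have he : computable (fun e : E * Q => e.1) by projections.
apply: (computable_has (f := fun e p => move1 src dst (S e.1) (x e.1) p e.2));
  last exact: computable_comp hD he.
have he2 : computable (fun e : E * Q * Q => e.1.1) by projections.
apply: computable_move1; try projections; exact: computable_comp he2.
Qed.

Lemma computable_post2 (E : countType) (S : E -> system N m) a D :
  computable S -> computable a -> computable D ->
  computable (fun e => post2 src dst (S e) (a e) (D e)).
Proof.
move=> hS ha hD.
have hx b : computable (fun e => (b, a e) : action m).
  exact: computable_pair (computable_const _ b) ha.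
exact/(computable_post hS (hx false))/(computable_post hS (hx true)).
Qed.

Lemma computable_successors :
  computable (fun e : system N m * node N m => successors src dst e.1 e.2).
Proof.
apply: computable_flatten.
pose succ (e : system N m * node N m) a : seq (node N m) :=
  (if all (fun b => dst a != dst b) e.2.1.2
   then [seq (p, e.2.1.2, post2 src dst e.1 a e.2.2)
        | p <- post2 src dst e.1 a [:: e.2.1.1]]
   else [::]) ++
  (if e.2.1.2 == [::]
   then [seq (p, [:: a], post2 src dst e.1 a e.2.2)
        | p <- post src dst e.1 (true, a) [:: e.2.1.1]]
   else [::]).
apply: (computable_map (f := succ)); last exact: computable_const.
apply: computable_cat; apply: computable_if; try exact: computable_const.
- apply: (computable_all (f := fun e b => dst e.2 != dst b)); last by projections.
  by apply/computable_neg/computable_eq; apply: computable_fin; projections.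
- apply: (computable_map (f := fun e p =>
    (p, e.1.2.1.2, post2 src dst e.1.1 e.2 e.1.2.2))).
    by apply: computable_pair; [apply: computable_pair|apply: computable_post2]; projections.
  by apply: computable_post2; try apply: computable_seq1; projections.
- by apply: computable_eq; [projections|apply: computable_const].
- apply: (computable_map (f := fun e p =>
    (p, [:: e.2], post2 src dst e.1.1 e.2 e.1.2.2))).
    by apply: computable_pair; [apply: computable_pair|apply: computable_post2];
      try apply: computable_seq1; projections.
  apply: computable_post;
      [by projections| |by apply: computable_seq1; projections].
  by apply: computable_pair; [apply: computable_const|projections].
Qed.

Lemma computable_bad :
  computable (fun e : system N m * node N m => bad src dst e.1 e.2).
Proof.
pose bad1 (e : system N m * node N m) a :=
  [|| e.2.2 == [::],
      has (fun b => [&& src b == dst a, post src dst e.1 (true, b) [:: e.2.1.1] != [::]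
                      & post2 src dst e.1 b e.2.2 == [::]]) (enum 'I_m)
    | has (fun p => p \notin e.2.2) (post src dst e.1 (false, a) [:: e.2.1.1])].
apply: (computable_has (f := bad1)); last by projections.
apply: computable_or; first by apply: computable_eq_nil; projections.
apply: computable_or.
  apply: (computable_has (f := fun e b =>
    [&& src b == dst e.2, post src dst e.1.1 (true, b) [:: e.1.2.1.1] != [::]
      & post2 src dst e.1.1 b e.1.2.2 == [::]])); last exact: computable_const.
  apply: computable_and; first by apply: computable_eq; apply: computable_fin; projections.
  apply: computable_and.
    apply/computable_neg/computable_eq_nil/computable_post;
      [by projections| |by apply: computable_seq1; projections].
    by apply: computable_pair; [apply: computable_const|projections].
  by apply: computable_eq_nil; apply: computable_post2; projections.
apply: (computable_has (f := fun (e : system N m * node N m * 'I_m) (p : Q) =>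
  p \notin e.1.2.2)).
  by apply/computable_neg/computable_mem; projections.
apply: computable_post;
      [by projections| |by apply: computable_seq1; projections].
by apply: computable_pair; [apply: computable_const|projections].
Qed.

Lemma computable_flatten_successors (E : countType) (S : E -> system N m) L :
  computable S -> computable L ->
  computable (fun e => flatten [seq successors src dst (S e) nd | nd <- L e]).
Proof.
move=> hS hL; apply: computable_flatten.
apply: (computable_map (f := fun e nd => successors src dst (S e) nd)) hL.
apply: (computable_comp2 computable_successors); last by projections.
by apply: computable_comp hS _; projections.
Qed.

Lemma computable_explored :
  computable (fun e : system N m * nat => explored src dst e.1 e.2).
Proof.
apply: (computable_iter (f := fun (e : system N m * nat) L =>
   L ++ flatten [seq successors src dst e.1 nd | nd <- L])
  (z := fun e => [:: (init e.1, [::], [:: init e.1])])).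
- by apply: computable_cat; [|apply: computable_flatten_successors]; projections.
- by projections.
have hinit : computable (fun e : system N m * nat => init e.1).
  by apply: computable_comp computable_init _; projections.
apply: computable_cons; last exact: computable_const.
apply: computable_pair; last exact: computable_cons hinit (computable_const _ _).
exact: computable_pair hinit (computable_const _ _).
Qed.

End Decision.

Theorem theorem4p16 (N m : nat) (src dst : 'I_m -> 'I_N) :
  0 < N ->
  (forall a : 'I_m, src a != dst a) ->
  oriented_ring src dst ->
  decidable_pred (@synchronizable N m src dst).
Proof.
move=> _ src_neq_dst ring.
(* On an oriented ring the receiver is the sender plus one modulo [N], which is injective on
   residues. *)
have src_of_dst a b : dst a = dst b -> src a = src b.
  move=> dst_ab; apply/val_inj/eqP.
  have /ring ea : exists c, src c = src a /\ dst c = dst a by exists a.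
  have /ring eb : exists c, src c = src b /\ dst c = dst b by exists b.
  move: ea; rewrite dst_ab eb => /eqP.
  rewrite -(addn1 (src a)) -(addn1 (src b)) eqn_modDr.
  by rewrite !modn_small ?ltn_ord // eq_sym.
(* The search stops at the first closed stage and answers whether that stage is free of bad
   nodes. *)
apply: (@decidable_search _ _
  (fun S n => all [in explored src dst S n]
     (flatten [seq successors src dst S nd | nd <- explored src dst S n]))
  (fun S n => ~~ has (bad src dst S) (explored src dst S n))).
- apply: (computable_all (f := fun e nd => nd \in explored src dst e.1 e.2)).
    apply: computable_mem; first exact/computable_snd/computable_id.
    apply: (computable_comp (computable_explored src dst)
      (f := fun e : system N m * nat * node N m => e.1)).
    exact/computable_fst/computable_id.
  apply: (@computable_flatten_successors _ _ src dst _ fst) (computable_explored src dst).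
  exact/computable_fst/computable_id.
- apply: computable_neg.
  apply: (computable_has (f := fun e nd => bad src dst e.1 nd))
    (computable_explored src dst).
  have id1 := computable_id (system N m * nat * node N m)%type.
  apply: (computable_comp2 (computable_bad src dst)); last exact: computable_snd.
  exact/computable_fst/computable_fst.
- exact: explored_closes.
move=> S n closed; split.
  by move=> /synchronizable_almost_sync/almost_sync_explored; apply.
move=> nbad; apply/almost_sync_synchronizable => //; apply/almost_sync_explored => // k.
by apply/hasPn => nd /(explored_closed closed); exact: (hasPn nbad).
Qed.
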